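(* Let $S$ be a finite poset. There exist polynomials $\phi^0_S(x), \phi^1_S(x) \in \mathbb{Z}[x]$ such that for any triangular algebra $\Lambda$ and any vertex $v$ in its quiver, \[ \phi_{\Lambda \xleftarrow{v} S}(x) = \phi_{\Lambda}(x) \cdot \phi^0_S(x) + \phi_{\Lambda^-}(x) \cdot \phi^1_S(x), \] where $\Lambda \xleftarrow{v} S$ is the insertion of $S$ into $\Lambda$ at $v$ and $\Lambda^- = (1-e_v)\Lambda(1-e_v)$.
   Context: Let $K$ be a field. For a finite quiver $Q$ with vertex set $Q_0$ and arrow set $Q_1$, write $h(\alpha)$ and $t(\alpha)$ for the vertices at which an arrow (or path) $\alpha$ starts and ends, respectively; paths are composed from left to right, and two paths $p,q$ are parallel if $h(p)=h(q)$ and $t(p)=t(q)$. A triangular algebra is a quotient $\Lambda = KQ/I$ where $Q$ is a finite quiver without oriented cycles and $I$ is an ideal generated by linear combinations of parallel paths of lengths at least $2$. Its Cartan matrix $C_\Lambda$ is indexed by $Q_0$, with $(C_\Lambda)_{ij} = \dim_K \mathrm{Hom}_\Lambda(P_i,P_j)$, $P_i = e_i\Lambda$; this is the dimension of the image in $KQ/I$ of the span of paths from $j$ to $i$. Its Coxeter polynomial is $\phi_\Lambda(x) = \det(xC_\Lambda + C_\Lambda^T)$ (equal to $1$ for the zero algebra). For $v\in Q_0$, $e_v$ is the corresponding primitive idempotent and $\Lambda^- = (1-e_v)\Lambda(1-e_v)$. The Hasse quiver $Q_S$ of a finite poset $S$ has the elements of $S$ as vertices and an arrow $s\to s'$ whenever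 $s'$ covers $s$. $S_{\min}$ and $S_{\max}$ are the sets of minimal and maximal elements of $S$. Insertion: let $\Lambda = KQ/I$ be a triangular algebra, $v\in Q_0$, $S$ a nonempty finite poset. The insertion $\Lambda \xleftarrow{v} S$ is $K\widetilde{Q}/\widetilde{I}$, where $\widetilde{Q}_0 = (Q_0\setminus\{v\})\cup S$, and $\widetilde{Q}_1$ consists of: the arrows $\gamma\in Q_1$ with $h(\gamma),t(\gamma)\ne v$; the arrows of $Q_S$; an arrow $(\alpha,s)$ from $h(\alpha)$ to $s$ for each $\alpha\in Q_1$ with $t(\alpha)=v$ and $s\in S_{\min}$; an arrow $(s,\beta)$ from $s$ to $t(\beta)$ for each $\beta\in Q_1$ with $h(\beta)=v$ and $s\in S_{\max}$. For a path $p$ in $Q$ ending at $v$ and $s\in S_{\min}$, let $(p,s)$ be obtained from $p$ by replacing its last arrow $\alpha$ by $(\alpha,s)$; define $(s,p)$ similarly for $p$ starting at $v$ and $s\in S_{\max}$. The ideal $\widetilde{I}$ is generated by: (1a) $\sum c_p (p,s)$ for $s\in S_{\min}$ and $\sum c_p p\in I$ a linear combination of parallel paths ending at $v$; (1b) $\sum c_p (s,p)$ for $s\in S_{\max}$ and $\sum c_p p\in I$ a linear combination of parallel paths starting at $v$; (2a) $q'-q''$ for parallel paths $q',q''$ in $Q_S$; (2b) $(\alpha,h(q'))q' - (\alpha,h(q''))q''$ for $\alpha\in Q_1$ ending at $v$ and paths $q',q''$ in $Q_S$ with $h(q'),h(q'')\in S_{\min}$, $t(q')=t(q'')$; (2c)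 $q'(t(q'),\beta)-q''(t(q''),\beta)$ for $\beta\in Q_1$ starting at $v$ and paths $q',q''$ in $Q_S$ with $t(q'),t(q'')\in S_{\max}$, $h(q')=h(q'')$; (2d) $(\alpha,h(q'))q'(t(q'),\beta)-(\alpha,h(q''))q''(t(q''),\beta)$ for $\alpha,\beta\in Q_1$ with $t(\alpha)=h(\beta)=v$ and paths $q',q''$ in $Q_S$ with $h(q'),h(q'')\in S_{\min}$, $t(q'),t(q'')\in S_{\max}$; (3) $\sum c_p\widetilde{p}$ for $\sum c_p p\in I$ a linear combination of parallel paths neither starting nor ending at $v$, where $\widetilde{p}=p$ if $p$ does not pass through $v$, and otherwise, writing $p=p'p''$ with $t(p')=h(p'')=v$, $\widetilde{p} = (p',h(q))\,q\,(t(q),p'')$ for some path $q$ in $Q_S$ with $h(q)\in S_{\min}$, $t(q)\in S_{\max}$ (the choice of $q$ is irrelevant modulo the other relations). The algebra $\Lambda\xleftarrow{v}S$ is again triangular. By convention $\Lambda \xleftarrow{v}\varnothing = \Lambda^-$. *)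

(* Defs.v *)
From HB Require Import structures.
From mathcomp Require Import all_boot all_order all_algebra.
From mathcomp Require Import finmap monalg.
From mathcomp Require Import boolp classical_sets functions.

Set Implicit Arguments.
Unset Strict Implicit.
Unset Printing Implicit Defensive.

Import Order.TTheory GRing.Theory.

Local Open Scope ring_scope.
Local Open Scope classical_set_scope.

(* A K-algebra is a ring R with a ring morphism from K to the centre of R.
   The library's [algType] is built on nonzero rings, which excludes the
   corner algebra (1 - e) A (1 - e) when e = 1. *)

Record kalgebra (K : fieldType) := KAlgebra {
  kalg_ring : pzRingType;
  kalg_scalar : {rmorphism K -> kalg_ring};
  kalg_central : forall c x, kalg_scalar c * x = x * kalg_scalar c
}.

Definition kalg_sort (K : fieldType) (A : kalgebra K) : Type := kalg_ring A.
Coercion kalg_sort : kalgebra >-> Sortclass.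

Section KAlgebraLmodule.
Variables (K : fieldType) (A : kalgebra K).

HB.instance Definition _ := GRing.PzRing.on (kalg_sort A).

Definition kalg_scale (c : K) (x : A) : A := kalg_scalar A c * x.

Lemma kalg_scaleA a b x : kalg_scale a (kalg_scale b x) = kalg_scale (a * b) x.
Proof. by rewrite /kalg_scale rmorphM mulrA. Qed.
Lemma kalg_scale1 : left_id 1 kalg_scale.
Proof. by move=> x; rewrite /kalg_scale rmorph1 mul1r. Qed.
Lemma kalg_scaleDr : right_distributive kalg_scale +%R.
Proof. by move=> c x y; rewrite /kalg_scale mulrDr. Qed.
Lemma kalg_scaleDl x : {morph kalg_scale^~ x : a b / a + b}.
Proof. by move=> a b; rewrite /kalg_scale rmorphD mulrDl. Qed.

HB.instance Definition _ := GRing.Zmodule_isLmodule.Build K (kalg_sort A)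
  kalg_scaleA kalg_scale1 kalg_scaleDr kalg_scaleDl.

Lemma kalg_scaleE (c : K) (x : A) : c *: x = kalg_scalar A c * x.
Proof. by []. Qed.
Lemma kalg_scaleAl (c : K) (x y : A) : c *: (x * y) = (c *: x) * y.
Proof. by rewrite !kalg_scaleE mulrA. Qed.
Lemma kalg_scaleAr (c : K) (x y : A) : c *: (x * y) = x * (c *: y).
Proof. by rewrite !kalg_scaleE !mulrA (kalg_central c x). Qed.

End KAlgebraLmodule.

(* Dimension of the subspace U of V; it is 0 when U is infinite-dimensional
   (or not a subspace). *)
Definition dimension (K : fieldType) (V : lmodType K) (U : set V) : nat :=
  xget 0%N [set n | exists f : {linear 'rV[K]_n -> V},
                      injective f /\ range f = U].

Section Ideals.
Variables (K : fieldType) (A : kalgebra K).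

Definition two_sided_ideal (J : set A) : Prop :=
  [/\ J 0, forall x y, J x -> J y -> J (x + y),
      forall a x, J x -> J (a * x) & forall a x, J x -> J (x * a)].

Record ideal := Ideal { ideal_set :> A -> Prop; idealP : two_sided_ideal ideal_set }.

Lemma smallest_ideal (G : set A) : two_sided_ideal (smallest two_sided_ideal G).
Proof.
split.
- by move=> J [[J0 _ _ _] _].
- by move=> x y Jx Jy J JG; have [[_ JD _ _] _] := JG; apply: JD; [exact: Jx|exact: Jy].
- by move=> a x Jx J JG; have [[_ _ JM _] _] := JG; apply: JM; exact: Jx.
- by move=> a x Jx J JG; have [[_ _ _ JM] _] := JG; apply: JM; exact: Jx.
Qed.

Definition ideal_gen (G : set A) : ideal := Ideal (smallest_ideal G).

Section Quotient.
Variable I : ideal.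

Definition ideal_pred : {pred A} := fun x => `[< I x >].

Lemma ideal_predP x : reflect (I x) (x \in ideal_pred).
Proof. exact: asboolP. Qed.

Lemma ideal_pred_zmod : zmod_closed ideal_pred.
Proof.
have [I0 ID IMl _] := idealP I.
split=> [|x y /ideal_predP Ix /ideal_predP Iy]; apply/ideal_predP => //.
by apply: ID => //; rewrite -mulN1r; exact: IMl.
Qed.

HB.instance Definition _ :=
  GRing.isZmodClosed.Build A ideal_pred ideal_pred_zmod.

Definition quotient_ring : Type := Quotient.quot ideal_pred.
HB.instance Definition _ := GRing.Zmodule.on quotient_ring.

Definition quot_pi (x : A) : quotient_ring := \pi_(Quotient.quot ideal_pred)%qT x.

Lemma quot_piE x y : quot_pi x = quot_pi y <-> I (x - y).
Proof.
rewrite /quot_pi; split=> [/eqP|Ixy].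
  by rewrite -Quotient.idealrBE => /ideal_predP.
by apply/eqP; rewrite -Quotient.idealrBE; apply/ideal_predP.
Qed.

Lemma quot_pi_surj (X : quotient_ring) : exists x, X = quot_pi x.
Proof. by exists (repr X); rewrite /quot_pi reprK. Qed.

Lemma quot_piD x y : quot_pi (x + y) = quot_pi x + quot_pi y.
Proof. by rewrite /quot_pi !piE. Qed.

Definition quot_mul (X Y : quotient_ring) : quotient_ring :=
  quot_pi (repr X * repr Y).

Lemma quot_repr x : I (repr (quot_pi x) - x).
Proof. by apply/quot_piE; rewrite /quot_pi reprK. Qed.

Lemma quot_piM x y : quot_mul (quot_pi x) (quot_pi y) = quot_pi (x * y).
Proof.
have [_ ID IMl IMr] := idealP I.
apply/quot_piE; set x' := repr _; set y' := repr _.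
have -> : x' * y' - x * y = (x' - x) * y' + x * (y' - y).
  by rewrite mulrBl mulrBr addrA subrK.
by apply: ID; [apply: IMr|apply: IMl]; exact: quot_repr.
Qed.

Lemma quot_mulA : associative quot_mul.
Proof.
move=> X Y Z.
have [x ->] := quot_pi_surj X; have [y ->] := quot_pi_surj Y.
by have [z ->] := quot_pi_surj Z; rewrite !quot_piM mulrA.
Qed.
Lemma quot_mul1 : left_id (quot_pi 1) quot_mul.
Proof. by move=> X; have [x ->] := quot_pi_surj X; rewrite quot_piM mul1r. Qed.
Lemma quot_mulr1 : right_id (quot_pi 1) quot_mul.
Proof. by move=> X; have [x ->] := quot_pi_surj X; rewrite quot_piM mulr1. Qed.
Lemma quot_mulDl : left_distributive quot_mul +%R.
Proof.
move=> X Y Z.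
have [x ->] := quot_pi_surj X; have [y ->] := quot_pi_surj Y.
by have [z ->] := quot_pi_surj Z; rewrite -quot_piD !quot_piM mulrDl quot_piD.
Qed.
Lemma quot_mulDr : right_distributive quot_mul +%R.
Proof.
move=> X Y Z.
have [x ->] := quot_pi_surj X; have [y ->] := quot_pi_surj Y.
by have [z ->] := quot_pi_surj Z; rewrite -quot_piD !quot_piM mulrDr quot_piD.
Qed.

HB.instance Definition _ := GRing.Zmodule_isPzRing.Build quotient_ring
  quot_mulA quot_mul1 quot_mulr1 quot_mulDl quot_mulDr.

Lemma quot_pi_zmod : zmod_morphism quot_pi.
Proof. by move=> x y; rewrite /quot_pi !piE. Qed.
Lemma quot_pi_monoid : monoid_morphism quot_pi.
Proof. by split=> // x y; rewrite -quot_piM. Qed.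
HB.instance Definition _ :=
  GRing.isZmodMorphism.Build A quotient_ring quot_pi quot_pi_zmod.
HB.instance Definition _ :=
  GRing.isMonoidMorphism.Build A quotient_ring quot_pi quot_pi_monoid.

Lemma quot_central c (X : quotient_ring) :
  (quot_pi \o kalg_scalar A) c * X = X * (quot_pi \o kalg_scalar A) c.
Proof.
by have [x ->] := quot_pi_surj X; rewrite /= -!rmorphM /= kalg_central.
Qed.

Definition quot_algebra : kalgebra K :=
  @KAlgebra K quotient_ring (quot_pi \o kalg_scalar A) quot_central.

End Quotient.
End Ideals.

Section RightModules.
Variables (K : fieldType) (A : kalgebra K).

Definition rmod_pred (e : A) : {pred A} := fun x => `[< exists a, x = e * a >].

Lemma rmod_predP e x : reflect (exists a, x = e * a) (x \in rmod_pred e).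
Proof. exact: asboolP. Qed.

Lemma rmod_pred_submod e : submod_closed (rmod_pred e).
Proof.
split; first by apply/rmod_predP; exists 0; rewrite mulr0.
move=> c _ _ /rmod_predP[a ->] /rmod_predP[b ->].
by apply/rmod_predP; exists (c *: a + b); rewrite mulrDr kalg_scaleAr.
Qed.

HB.instance Definition _ e :=
  GRing.isSubmodClosed.Build K A (rmod_pred e) (rmod_pred_submod e).

Definition rmod (e : A) : Type := {x : A | x \in rmod_pred e}.
HB.instance Definition _ e := SubChoice.on (rmod e).
HB.instance Definition _ e := [SubChoice_isSubLmodule of rmod e by <:].

Lemma ract_proof e (x : rmod e) (a : A) : val x * a \in rmod_pred e.
Proof.
by have /rmod_predP[b ->] := valP x; apply/rmod_predP; exists (b * a); rewrite mulrA.
Qed.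
Definition ract e (x : rmod e) (a : A) : rmod e := Sub (val x * a) (ract_proof x a).

(* Right-module homomorphisms e A -> e' A. They are automatically K-linear, as
   c *: x = x * c for c in K. *)
Definition rmod_hom (e e' : A) : set (rmod e -> rmod e') :=
  [set f | (forall x y, f (x + y) = f x + f y) /\
           (forall x a, f (ract x a) = ract (f x) a)].
Arguments rmod_hom : clear implicits.

Definition hom_dim (e e' : A) : nat := dimension (rmod_hom e e').

End RightModules.

Section Corner.
Variables (K : fieldType) (A : kalgebra K) (f : A).

Definition corner_pred : {pred A} := fun x => `[< exists a, x = f * a * f >].

Lemma corner_predP x : reflect (exists a, x = f * a * f) (x \in corner_pred).
Proof. exact: asboolP. Qed.

Lemma corner_pred_submod : submod_closed corner_pred.
Proof.
split; first by apply/corner_predP; exists 0; rewrite mulr0 mul0r.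
move=> c _ _ /corner_predP[a ->] /corner_predP[b ->].
apply/corner_predP; exists (c *: a + b).
by rewrite mulrDr mulrDl -kalg_scaleAr -kalg_scaleAl.
Qed.

HB.instance Definition _ :=
  GRing.isSubmodClosed.Build K A corner_pred corner_pred_submod.

Hypothesis ff : f * f = f.

(* The proof of idempotency is recorded because f is the unit of f A f. *)
Definition corner_ring of f * f = f : Type := {x : A | x \in corner_pred}.
Local Notation C := (corner_ring ff).
HB.instance Definition _ := SubChoice.on C.
HB.instance Definition _ := [SubChoice_isSubLmodule of C by <:].

Lemma corner_one_proof : f \in corner_pred.
Proof. by apply/corner_predP; exists f; rewrite !ff. Qed.
Lemma corner_mul_proof (x y : C) : val x * val y \in corner_pred.
Proof.
have /corner_predP[a ->] := valP x; have /corner_predP[b ->] := valP y.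
by apply/corner_predP; exists (a * f * (f * b)); rewrite !mulrA.
Qed.
Definition corner_one : C := Sub f corner_one_proof.
Definition corner_mul (x y : C) : C := Sub (val x * val y) (corner_mul_proof x y).

Lemma corner_fl (x : C) : f * val x = val x.
Proof. by have /corner_predP[a ->] := valP x; rewrite !mulrA ff. Qed.
Lemma corner_fr (x : C) : val x * f = val x.
Proof. by have /corner_predP[a ->] := valP x; rewrite -!mulrA ff. Qed.

Lemma corner_mulA : associative corner_mul.
Proof. by move=> x y z; apply: val_inj; rewrite /= mulrA. Qed.
Lemma corner_mul1 : left_id corner_one corner_mul.
Proof. by move=> x; apply: val_inj; rewrite /= corner_fl. Qed.
Lemma corner_mulr1 : right_id corner_one corner_mul.
Proof. by move=> x; apply: val_inj; rewrite /= corner_fr. Qed.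
Lemma corner_mulDl : left_distributive corner_mul +%R.
Proof. by move=> x y z; apply: val_inj; rewrite /= mulrDl. Qed.
Lemma corner_mulDr : right_distributive corner_mul +%R.
Proof. by move=> x y z; apply: val_inj; rewrite /= mulrDr. Qed.

HB.instance Definition _ := GRing.Zmodule_isPzRing.Build C
  corner_mulA corner_mul1 corner_mulr1 corner_mulDl corner_mulDr.

Lemma corner_scalar_proof c : f * kalg_scalar A c \in corner_pred.
Proof.
apply/corner_predP; exists (kalg_scalar A c).
by rewrite -mulrA kalg_central mulrA ff.
Qed.
Definition corner_scalar (c : K) : C :=
  Sub (f * kalg_scalar A c) (corner_scalar_proof c).

Lemma corner_scalar_zmod : zmod_morphism corner_scalar.
Proof. by move=> a b; apply: val_inj; rewrite /= rmorphB mulrBr. Qed.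
Lemma corner_scalar_monoid : monoid_morphism corner_scalar.
Proof.
split=> [|a b]; apply: val_inj; rewrite /= ?rmorph1 ?mulr1 //.
by rewrite rmorphM [LHS]mulrA [RHS]mulrA -(mulrA f _ f) kalg_central (mulrA f f) ff.
Qed.
HB.instance Definition _ :=
  GRing.isZmodMorphism.Build K C corner_scalar corner_scalar_zmod.
HB.instance Definition _ :=
  GRing.isMonoidMorphism.Build K C corner_scalar corner_scalar_monoid.

Lemma corner_central c (x : C) : corner_scalar c * x = x * corner_scalar c.
Proof.
apply: val_inj; change (f * kalg_scalar A c * val x = val x * (f * kalg_scalar A c)).
by rewrite -mulrA kalg_central !mulrA corner_fl corner_fr.
Qed.

Definition corner_algebra : kalgebra K := KAlgebra corner_central.

End Corner.

Section LinearExtension.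
Variables (K : fieldType) (P : choiceType) (V : lmodType K).
Implicit Types (F : P -> V) (f : {malg K[P]}).

Definition lext F f : V := \sum_(p <- msupp f) f@_p *: F p.

Lemma lextEw (d : {fset P}) F f : (msupp f `<=` d)%fset ->
  lext F f = \sum_(p <- d) f@_p *: F p.
Proof.
move=> le; rewrite /lext (big_fset_incl _ le) //= => x _ /mcoeff_outdom ->.
by rewrite scale0r.
Qed.

Lemma lext_linear F : linear (lext F).
Proof.
move=> c f g; pose d := (msupp f `|` msupp g)%fset.
have lef : (msupp f `<=` d)%fset by exact: fsubsetUl.
have leg : (msupp g `<=` d)%fset by exact: fsubsetUr.
have le : (msupp (c *: f + g) `<=` d)%fset.
  apply: fsubset_trans (msuppD_le _ _) _.
  by rewrite fsubUset leg andbT; apply: fsubset_trans (msuppZ_le _ _) lef.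
rewrite !(@lextEw d) // scaler_sumr -big_split /=.
by apply: eq_bigr => p _; rewrite mcoeffD mcoeffZ scalerDl scalerA.
Qed.

HB.instance Definition _ F :=
  GRing.isLinear.Build K {malg K[P]} V *:%R (lext F) (lext_linear F).

Lemma lextU F p : lext F << p >> = F p.
Proof. by rewrite (lextEw F msuppU_le) big_seq_fset1 mcoeffUU scale1r. Qed.

Lemma eq_lext F F' f : F =1 F' -> lext F f = lext F' f.
Proof. by move=> eF; apply: eq_bigr => p _; rewrite eF. Qed.

Lemma lext_sumF F F' f : lext (fun p => F p + F' p) f = lext F f + lext F' f.
Proof. by rewrite /lext -big_split; apply: eq_bigr => p _; rewrite scalerDr. Qed.

Lemma lext0F f : lext (fun=> 0) f = 0.
Proof. by rewrite /lext big1 // => p _; rewrite scaler0. Qed.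

End LinearExtension.

Lemma lext_id (K : fieldType) (P : choiceType) (f : {malg K[P]}) :
  lext (fun p => << p >>) f = f.
Proof.
rewrite [RHS]monalgE; apply: eq_bigr => p _.
by apply/malgP => q; rewrite mcoeffZ !mcoeffU mulr_natr.
Qed.

Lemma linear_lext (K : fieldType) (P : choiceType) (V W : lmodType K)
    (phi : {linear V -> W}) (F : P -> V) f :
  phi (lext F f) = lext (phi \o F) f.
Proof. by rewrite /lext linear_sum; apply: eq_bigr => p _; rewrite linearZ. Qed.

(* [src] and [tgt] are the vertices where an arrow starts and ends, often denoted
   h and t. *)
Record quiver := Quiver {
  vert : finType;
  arr : finType;
  src : arr -> vert;
  tgt : arr -> vert
}.

Section Paths.
Variable Q : quiver.

Fixpoint chain (x : vert Q) (w : seq (arr Q)) : bool :=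
  if w is a :: w' then (src a == x) && chain (tgt a) w' else true.

(* A path is its starting vertex with its sequence of arrows, read from left
   to right; the trivial path e_i has no arrow. *)
Record qpath := QPath {
  qpath_val : vert Q * seq (arr Q);
  qpath_chain : chain qpath_val.1 qpath_val.2
}.

HB.instance Definition _ := [isSub for qpath_val].
HB.instance Definition _ := [Choice of qpath by <:].

Definition pstart (p : qpath) : vert Q := (val p).1.
Definition parrows (p : qpath) : seq (arr Q) := (val p).2.
Definition pend (p : qpath) : vert Q :=
  last (pstart p) [seq tgt a | a <- parrows p].

Definition ptriv (i : vert Q) : qpath := @QPath (i, [::]) isT.

Lemma qpath_valE p : val p = (pstart p, parrows p).
Proof. by rewrite /pstart /parrows; case: (val p). Qed.

Definition pcomp (p q : qpath) : option qpath :=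
  if pend p == pstart q then insub (pstart p, parrows p ++ parrows q) else None.

Definition acyclic : Prop :=
  forall p : qpath, pstart p = pend p -> parrows p = [::].

Lemma chain_cat x w1 w2 : chain x (w1 ++ w2) =
  chain x w1 && chain (last x [seq tgt a | a <- w1]) w2.
Proof. by elim: w1 x => //= a w1 IH x; rewrite IH andbA. Qed.

Lemma pcompN p q : pend p != pstart q -> pcomp p q = None.
Proof. by rewrite /pcomp => /negPf ->. Qed.

Lemma pcompS p q : pend p = pstart q -> exists r, [/\ pcomp p q = Some r,
  val r = (pstart p, parrows p ++ parrows q), pstart r = pstart p &
  pend r = pend q].
Proof.
move=> e; rewrite /pcomp e eqxx.
have H : chain (pstart p) (parrows p ++ parrows q).
  by rewrite chain_cat (qpath_chain p) -/(pend p) e (qpath_chain q).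
exists (Sub (pstart p, parrows p ++ parrows q) H : qpath); split => //.
  by rewrite (insubT _ (H : (fun u => chain u.1 u.2) (pstart p, parrows p ++ parrows q))); congr Some; exact: val_inj.
by rewrite /pend /pstart /parrows /= map_cat last_cat -/(pend p) e.
Qed.

Lemma pcomp_ptrivl i q : pcomp (ptriv i) q = if i == pstart q then Some q else None.
Proof.
have [e|ne] := eqVneq i (pstart q); last exact: pcompN.
have [r [-> rE _ _]] := pcompS (e : pend (ptriv i) = pstart q).
congr Some; apply: val_inj; by rewrite rE qpath_valE /= e.
Qed.

Lemma pcomp_ptrivr p i : pcomp p (ptriv i) = if pend p == i then Some p else None.
Proof.
have [e|ne] := eqVneq (pend p) i; last exact: pcompN.
have [r [-> rE _ _]] := pcompS (e : pend p = pstart (ptriv i)).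
congr Some; apply: val_inj; by rewrite rE qpath_valE /= cats0.
Qed.

Lemma pcompA p q r : obind (pcomp p) (pcomp q r) = obind (pcomp^~ r) (pcomp p q).
Proof.
have [e|ne] := eqVneq (pend p) (pstart q); last first.
  rewrite (pcompN ne) /=; have [e'|ne'] := eqVneq (pend q) (pstart r).
    by have [s [-> _ es _]] := pcompS e'; rewrite /= pcompN ?es.
  by rewrite (pcompN ne').
have [s [-> sE es fs]] := pcompS e.
have [e'|ne'] := eqVneq (pend q) (pstart r); last first.
  by rewrite (pcompN ne') /= pcompN ?fs.
have [t [-> tE et _]] := pcompS e'.
have [u [/= -> uE _ _]] := pcompS (etrans e (esym et)).
have [u' [-> uE' _ _]] := pcompS (etrans fs e').
congr Some; apply: val_inj; rewrite [LHS]uE [RHS]uE' es.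
by rewrite /parrows sE tE /= catA.
Qed.

End Paths.

Section PathAlgebra.
Variables (K : fieldType) (Q : quiver).
Local Notation KQ := {malg K[qpath Q]}.

Definition path_ring : Type := KQ.
HB.instance Definition _ := GRing.Lmodule.on path_ring.

Definition pprod (p q : qpath Q) : path_ring := oapp (fun r => << r >>) 0 (pcomp p q).

Definition path_one : path_ring := \sum_(i : vert Q) << ptriv i >>.
Definition path_mul (f g : path_ring) : path_ring :=
  lext (fun p => lext (pprod p) g) f.

Lemma pprodA p q r : lext (pprod p) (pprod q r) = lext (pprod^~ r) (pprod p q).
Proof.
transitivity (oapp (fun u => << u >>) 0 (obind (pcomp p) (pcomp q r)) : path_ring).
  by rewrite {2}/pprod; case: (pcomp q r) => [u|] /=; rewrite ?lextU ?linear0.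
rewrite pcompA [in RHS]/pprod; case: (pcomp p q) => [u|] /=.
  by rewrite lextU.
by rewrite linear0.
Qed.

Lemma path_mulA : associative path_mul.
Proof.
move=> f g h; rewrite /path_mul.
rewrite [RHS]linear_lext; apply: eq_lext => p /=.
rewrite [LHS]linear_lext [RHS]linear_lext; apply: eq_lext => q /=.
transitivity (lext (fun r => lext (pprod^~ r) (pprod p q)) h).
  rewrite [LHS]linear_lext; apply: eq_lext => r; exact: pprodA.
case E: (pcomp p q) => [u|].
  have -> : pprod p q = << u >> by rewrite /pprod E.
  by rewrite [RHS]lextU; apply: eq_lext => r; rewrite lextU.
have -> : pprod p q = 0 by rewrite /pprod E.
by rewrite [RHS]linear0 -[RHS](lext0F _ h); apply: eq_lext => r; rewrite linear0.
Qed.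

Lemma path_mul1 : left_id path_one path_mul.
Proof.
move=> f; rewrite /path_mul /path_one linear_sum /= -[RHS]lext_id.
rewrite (eq_bigr (fun i => lext (pprod (ptriv i)) f)) => [|i _]; last by rewrite lextU.
rewrite /lext exchange_big; apply: eq_bigr => p _; rewrite -scaler_sumr.
congr (_ *: _); rewrite (bigD1 (pstart p)) //= big1 ?addr0.
  by rewrite /pprod pcomp_ptrivl eqxx.
by move=> i /negPf ne; rewrite /pprod pcomp_ptrivl ne.
Qed.

Lemma path_mulr1 : right_id path_one path_mul.
Proof.
move=> f; rewrite /path_mul -[RHS]lext_id; apply: eq_lext => p.
rewrite /path_one linear_sum (bigD1 (pend p)) //= big1 ?addr0.
  by rewrite lextU /pprod pcomp_ptrivr eqxx.
by move=> i /negPf ne; rewrite lextU /pprod pcomp_ptrivr eq_sym ne.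
Qed.

Lemma path_mulDl : left_distributive path_mul +%R.
Proof. by move=> f g h; rewrite /path_mul linearD. Qed.
Lemma path_mulDr : right_distributive path_mul +%R.
Proof.
by move=> f g h; rewrite /path_mul -lext_sumF; apply: eq_lext => p; rewrite linearD.
Qed.

HB.instance Definition _ := GRing.Zmodule_isPzRing.Build path_ring
  path_mulA path_mul1 path_mulr1 path_mulDl path_mulDr.

Lemma path_scaleAl (c : K) (f g : path_ring) : c *: (f * g) = (c *: f) * g.
Proof. by rewrite /GRing.mul /= /path_mul linearZ. Qed.
Lemma path_scaleAr (c : K) (f g : path_ring) : c *: (f * g) = f * (c *: g).
Proof.
rewrite /GRing.mul /= /path_mul {1 3}/lext scaler_sumr; apply: eq_bigr => p _.
have -> : lext (pprod p) (c *: g) = c *: lext (pprod p) g by exact: linearZ.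
by rewrite [LHS]scalerA [RHS]scalerA mulrC.
Qed.

Definition path_scalar (c : K) : path_ring := c *: (1 : path_ring).

Lemma path_scalar_zmod : zmod_morphism path_scalar.
Proof. by move=> a b; rewrite /path_scalar scalerBl. Qed.
Lemma path_scalar_monoid : monoid_morphism path_scalar.
Proof.
split=> [|a b]; first exact: scale1r.
by rewrite /path_scalar -path_scaleAl mul1r scalerA.
Qed.
HB.instance Definition _ :=
  GRing.isZmodMorphism.Build K path_ring path_scalar path_scalar_zmod.
HB.instance Definition _ :=
  GRing.isMonoidMorphism.Build K path_ring path_scalar path_scalar_monoid.

Lemma path_central c (f : path_ring) : path_scalar c * f = f * path_scalar c.
Proof. by rewrite /path_scalar -path_scaleAl -path_scaleAr mul1r mulr1. Qed.

Definition path_algebra : kalgebra K := KAlgebra path_central.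

Definition pelt (p : qpath Q) : path_algebra := << p >> : path_ring.

Lemma pelt_orth i j :
  pelt (ptriv i) * pelt (ptriv j) = if i == j then pelt (ptriv i) else 0.
Proof.
rewrite /GRing.mul /= /path_mul /pelt !lextU /pprod pcomp_ptrivl /=.
by rewrite /pstart /=; case: eqVneq => [->|].
Qed.
End PathAlgebra.

Section Coxeter.
Variable K : fieldType.

(* An algebra with a family of orthogonal idempotents of sum 1; for the
   algebras below these are the primitive idempotents e_i of the vertices i. *)
Record idem_algebra := IdemAlgebra {
  ia_vert : finType;
  ia_alg : kalgebra K;
  ia_idem : ia_vert -> ia_alg;
  ia_orth : forall i j, ia_idem i * ia_idem j = if i == j then ia_idem i else 0;
  ia_sum : \sum_i ia_idem i = 1
}.

Definition cartan (A : idem_algebra) : 'M[int]_#|ia_vert A| :=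
  \matrix_(i, j) (hom_dim (ia_idem (enum_val i : ia_vert A))
                         (ia_idem (enum_val j : ia_vert A)))%:Z.

Definition coxeter_poly (A : idem_algebra) : {poly int} :=
  let C := map_mx polyC (cartan A) in \det ('X *: C + C^T).

Section IdemCorner.
Variables (A : idem_algebra) (v : ia_vert A).
Local Notation e := (@ia_idem A).
Local Notation f := (1 - e v).

Lemma idem_complK : f * f = f.
Proof. by rewrite mulrBl mul1r mulrBr mulr1 ia_orth eqxx subrr subr0. Qed.

Lemma idem_compl_mul i : i != v -> f * e i * f = e i.
Proof.
move=> /negPf ne.
by rewrite mulrBl mul1r ia_orth eq_sym ne subr0 mulrBr mulr1 ia_orth ne subr0.
Qed.

Lemma corner_idem_proof (i : {i | i != v}) : e (val i) \in corner_pred f.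
Proof. by apply/corner_predP; exists (e (val i)); rewrite (idem_compl_mul (valP i)). Qed.

Definition corner_idem (i : {i | i != v}) : corner_algebra idem_complK :=
  (Sub (e (val i)) (corner_idem_proof i) : corner_ring idem_complK).

Lemma corner_idem_orth i j :
  corner_idem i * corner_idem j = if i == j then corner_idem i else 0.
Proof.
apply: val_inj; transitivity (e (val i) * e (val j)) => //.
by rewrite ia_orth -val_eqE; case: eqP.
Qed.

Lemma corner_idem_sum : \sum_i corner_idem i = 1.
Proof.
apply: val_inj; rewrite (raddf_sum (val : corner_ring idem_complK -> ia_alg A)) /=.
change (\sum_(i : {i | i != v}) e (val i) = f).
rewrite -(ia_sum A) [in RHS](bigD1 v) //= addrAC subrr add0r.
rewrite [RHS](reindex_omap (val : {i | i != v} -> ia_vert A) insub) /=; last first.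
  by move=> i iv; rewrite insubT.
by apply: eq_bigl => i; rewrite (valP i) valK eqxx.
Qed.

Definition idem_corner : idem_algebra :=
  IdemAlgebra corner_idem_orth corner_idem_sum.

End IdemCorner.

Section BoundQuiver.
Variables (Q : quiver) (I : ideal (path_algebra K Q)).

Definition vertex_idem (i : vert Q) : quot_algebra I := quot_pi I (pelt K (ptriv i)).

Lemma vertex_idem_orth i j :
  vertex_idem i * vertex_idem j = if i == j then vertex_idem i else 0.
Proof.
rewrite /vertex_idem; transitivity (quot_pi I (pelt K (ptriv i) * pelt K (ptriv j))).
  by rewrite rmorphM.
by rewrite pelt_orth; case: eqP => // _; rewrite rmorph0.
Qed.

Lemma vertex_idem_sum : \sum_i vertex_idem i = 1.
Proof.
transitivity (quot_pi I (\sum_i pelt K (ptriv i))); first by rewrite rmorph_sum.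
by rewrite -[RHS](rmorph1 (quot_pi I)).
Qed.

Definition quiver_algebra : idem_algebra :=
  IdemAlgebra vertex_idem_orth vertex_idem_sum.

End BoundQuiver.
End Coxeter.

Definition parallel_comb (K : fieldType) (Q : quiver) (P : qpath Q -> Prop)
    (x : path_ring K Q) : Prop :=
  exists i j, forall p, p \in msupp x -> [/\ pstart p = i, pend p = j & P p].

Record triangular (K : fieldType) := Triangular {
  tri_quiver : quiver;
  tri_acyclic : acyclic tri_quiver;
  tri_rels : set (path_ring K tri_quiver);
  tri_rels_parallel : forall x, tri_rels x ->
    parallel_comb (fun p => (2 <= size (parrows p))%N) x
}.

Arguments tri_rels {K} t : rename.

Definition tri_ideal (K : fieldType) (L : triangular K) :
    ideal (path_algebra K (tri_quiver L)) :=
  ideal_gen (tri_rels L : set (path_algebra K (tri_quiver L))).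

Definition tri_algebra (K : fieldType) (L : triangular K) : idem_algebra K :=
  quiver_algebra (tri_ideal L).

Section Hasse.
Variables (d : Order.disp_t) (S : finPOrderType d).
Local Open Scope order_scope.

Definition covered (s s' : S) : bool := (s < s') && [forall t, ~~ (s < t < s')].
Definition is_minimal (s : S) : bool := [forall t, ~~ (t < s)].
Definition is_maximal (s : S) : bool := [forall t, ~~ (s < t)].

Definition hasse : quiver :=
  @Quiver S {u : S * S | covered u.1 u.2} (fun u => (val u).1) (fun u => (val u).2).

End Hasse.

Section Insertion.
Variables (K : fieldType) (L : triangular K) (v : vert (tri_quiver L)).
Variables (d : Order.disp_t) (S : finPOrderType d).
Local Notation Q := (tri_quiver L).

(* Old g is the arrow g of Q, Hasse s s' the arrow s -> s' of the Hasse quiver,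
   In a s and Out s b are the arrows (a, s) and (s, b). *)
Variant raw_arrow :=
  | Old of arr Q
  | Hasse of S & S
  | In of arr Q & S
  | Out of S & arr Q.

Definition raw_code (a : raw_arrow) : arr Q + (S * S + (arr Q * S + S * arr Q)) :=
  match a with
  | Old g => inl g
  | Hasse s s' => inr (inl (s, s'))
  | In a s => inr (inr (inl (a, s)))
  | Out s b => inr (inr (inr (s, b)))
  end.
Definition raw_decode (c : arr Q + (S * S + (arr Q * S + S * arr Q))) : raw_arrow :=
  match c with
  | inl g => Old g
  | inr (inl (s, s')) => Hasse s s'
  | inr (inr (inl (a, s))) => In a s
  | inr (inr (inr (s, b))) => Out s b
  end.
Lemma raw_codeK : cancel raw_code raw_decode.
Proof. by case. Qed.

HB.instance Definition _ := Equality.copy raw_arrow (can_type raw_codeK).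
HB.instance Definition _ := Choice.copy raw_arrow (can_type raw_codeK).
HB.instance Definition _ := Countable.copy raw_arrow (can_type raw_codeK).
HB.instance Definition _ := Finite.copy raw_arrow (can_type raw_codeK).

Definition is_ins_arrow (a : raw_arrow) : bool :=
  match a with
  | Old g => (src g != v) && (tgt g != v)
  | Hasse s s' => covered s s'
  | In a s => (tgt a == v) && is_minimal s
  | Out s b => (src b == v) && is_maximal s
  end.

Definition raw_src (a : raw_arrow) : vert Q + S :=
  match a with
  | Old g => inl (src g)
  | Hasse s _ => inr s
  | In a _ => inl (src a)
  | Out s _ => inr s
  end.
Definition raw_tgt (a : raw_arrow) : vert Q + S :=
  match a with
  | Old g => inl (tgt g)
  | Hasse _ s' => inr s'
  | In _ s => inr s
  | Out _ b => inl (tgt b)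
  end.

Definition ins_vert : finType := {x : vert Q + S | x != inl v}.
Definition ins_arr : finType := {a : raw_arrow | is_ins_arrow a}.

Lemma no_loop (a : arr Q) : src a != tgt a.
Proof.
apply/negP => /eqP e.
have H : chain (src a) [:: a] by rewrite /= eqxx.
by have := tri_acyclic (p := @QPath Q (src a, [:: a]) H) e.
Qed.

Lemma ins_src_proof (a : ins_arr) : raw_src (val a) != inl v.
Proof.
case: a => -[g|s s'|a s|s b] //= => [/andP[]|/andP[/eqP <- _]] //.
exact: no_loop.
Qed.
Lemma ins_tgt_proof (a : ins_arr) : raw_tgt (val a) != inl v.
Proof.
case: a => -[g|s s'|a s|s b] //= => [/andP[]|/andP[/eqP <- _]] //.
by rewrite eq_sym; exact: no_loop.
Qed.

Definition ins_quiver : quiver :=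
  @Quiver ins_vert ins_arr (fun a => Sub (raw_src (val a)) (ins_src_proof a))
                           (fun a => Sub (raw_tgt (val a)) (ins_tgt_proof a)).

(* r is the path of the inserted quiver starting at x with arrows w. *)
Definition spells (r : qpath ins_quiver) (x : vert Q + S) (w : seq raw_arrow) : Prop :=
  val (pstart r) = x /\ [seq val a | a <- parrows r] = w.

Definition hasse_word (q : qpath (hasse S)) : seq raw_arrow :=
  [seq Hasse (val u).1 (val u).2 | u <- parrows q].

(* r = (p, s), for p ending at v *)
Definition path_into (s : S) (p : qpath Q) (r : qpath ins_quiver) : Prop :=
  exists w a, parrows p = rcons w a /\
    spells r (inl (pstart p)) (rcons (map Old w) (In a s)).

(* r = (s, p), for p starting at v *)
Definition path_out_of (s : S) (p : qpath Q) (r : qpath ins_quiver) : Prop :=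
  exists b w, parrows p = b :: w /\ spells r (inr s) (Out s b :: map Old w).

(* r is a path p~ obtained from p, for p neither starting nor ending at v. Every
   choice of the path q from a minimal to a maximal element of S is allowed;
   they all agree modulo [ins_rel2d]. *)
Definition path_lift (p : qpath Q) (r : qpath ins_quiver) : Prop :=
  ((forall a, a \in parrows p -> tgt a != v) /\
   spells r (inl (pstart p)) (map Old (parrows p))) \/
  (exists w1 a b w2 (q : qpath (hasse S)),
    [/\ parrows p = w1 ++ a :: b :: w2, tgt a = v,
        is_minimal (pstart q), is_maximal (pend q) &
        spells r (inl (pstart p))
          (map Old w1 ++ In a (pstart q) :: hasse_word q ++ Out (pend q) b :: map Old w2)]).

Local Notation KQ := (path_ring K Q).
Local Notation KQi := (path_ring K ins_quiver).
Local Notation "[ r ]" := (pelt K r : KQi).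

(* In [ins_rel1a], [ins_rel1b] and [ins_rel3], x is the combination
   sum c_p p in I, l maps each p in its support to the path replacing it, and
   [lext] produces sum c_p (l p). *)
Inductive ins_rels : set KQi :=
| ins_rel1a (s : S) (x : KQ) (l : qpath Q -> qpath ins_quiver) :
    is_minimal s -> tri_ideal L x -> parallel_comb (fun p => pend p = v) x ->
    (forall p, p \in msupp x -> path_into s p (l p)) ->
    ins_rels (lext (fun p => [l p]) x)
| ins_rel1b (s : S) (x : KQ) (l : qpath Q -> qpath ins_quiver) :
    is_maximal s -> tri_ideal L x -> parallel_comb (fun p => pstart p = v) x ->
    (forall p, p \in msupp x -> path_out_of s p (l p)) ->
    ins_rels (lext (fun p => [l p]) x)
| ins_rel2a (q' q'' : qpath (hasse S)) (r' r'' : qpath ins_quiver) :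
    pstart q' = pstart q'' -> pend q' = pend q'' ->
    spells r' (inr (pstart q')) (hasse_word q') ->
    spells r'' (inr (pstart q'')) (hasse_word q'') ->
    ins_rels ([r'] - [r''])
| ins_rel2b (a : arr Q) (q' q'' : qpath (hasse S)) (r' r'' : qpath ins_quiver) :
    tgt a = v -> is_minimal (pstart q') -> is_minimal (pstart q'') ->
    pend q' = pend q'' ->
    spells r' (inl (src a)) (In a (pstart q') :: hasse_word q') ->
    spells r'' (inl (src a)) (In a (pstart q'') :: hasse_word q'') ->
    ins_rels ([r'] - [r''])
| ins_rel2c (b : arr Q) (q' q'' : qpath (hasse S)) (r' r'' : qpath ins_quiver) :
    src b = v -> is_maximal (pend q') -> is_maximal (pend q'') ->
    pstart q' = pstart q'' ->
    spells r' (inr (pstart q')) (rcons (hasse_word q') (Out (pend q') b)) ->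
    spells r'' (inr (pstart q'')) (rcons (hasse_word q'') (Out (pend q'') b)) ->
    ins_rels ([r'] - [r''])
| ins_rel2d (a b : arr Q) (q' q'' : qpath (hasse S)) (r' r'' : qpath ins_quiver) :
    tgt a = v -> src b = v ->
    is_minimal (pstart q') -> is_minimal (pstart q'') ->
    is_maximal (pend q') -> is_maximal (pend q'') ->
    spells r' (inl (src a))
      (In a (pstart q') :: rcons (hasse_word q') (Out (pend q') b)) ->
    spells r'' (inl (src a))
      (In a (pstart q'') :: rcons (hasse_word q'') (Out (pend q'') b)) ->
    ins_rels ([r'] - [r''])
| ins_rel3 (x : KQ) (l : qpath Q -> qpath ins_quiver) :
    tri_ideal L x -> parallel_comb (fun p => pstart p != v /\ pend p != v) x ->
    (forall p, p \in msupp x -> path_lift p (l p)) ->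
    ins_rels (lext (fun p => [l p]) x).

Definition ins_ideal : ideal (path_algebra K ins_quiver) :=
  ideal_gen (ins_rels : set (path_algebra K ins_quiver)).

Definition tri_corner : idem_algebra K := @idem_corner K (tri_algebra L) v.

(* The empty poset is inserted by convention as the corner algebra. *)
Definition insertion : idem_algebra K :=
  if #|S| == 0%N then tri_corner else quiver_algebra ins_ideal.

End Insertion.

(* Main.v *)
From HB Require Import structures.
Require Import Defs.
From mathcomp Require Import all_boot all_order all_algebra perm fraction ring.
From mathcomp Require Import finmap monalg.
From mathcomp Require Import boolp classical_sets functions.

(** Inserting S at v repeats the row and the column of v in the Cartan matrix,
    once for each element of S, and puts the incidence matrix of S where they
    meet. Nothing else changes.

    In detail, let B be the insertion and A the given algebra, and let pi send
    a vertex of the new quiver to the vertex of the old one that it comes from,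
    all of S going to v. Since Hom(eA, e'A) = e'Ae ([hom_dim_peirce]), Cartan
    matrices are read off from Peirce components, and e_x B e_y is isomorphic
    to e_pi(x) A e_pi(y), except that it is 0 when x and y are in S and x is
    not below y ([hom_dim_insertion]).

    The isomorphism comes from the functor [collapse], which contracts S to v in
    a path of the new quiver. As the old quiver has no oriented cycle, a path goes
    through S at most once, so a path with given ends is determined by its
    contraction up to its segment inside S, which does not matter modulo the
    relations ([collapse_congr]). Contraction maps the relations of B into those
    of A ([collapse_ideal]), and any choice of lifts of paths maps the relations
    of A into those of B ([lift_ideal]). Lifts exist except between elements of
    S that are not in increasing order ([lift_exists]). So contraction and
    lifting induce inverse bijections ([peirce_iso]).

    It remains to compute determinants. Let M be the matrix x C + C^T of the
    corner algebra and N the one of the incidence algebra of S. With a column u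
    and a row w, the matrix of A has the blocks M, u, w, x + 1, the last because
    e_v A e_v has dimension 1, and the matrix of B has the blocks M, u 1, 1 w, N
    with all-one rows and columns 1. Both determinants depend on the borders
    only through w adj(M) u, and its elimination ([det_insert]) gives the formula
    with phi0 the sum of the entries of adj(N) and
    phi1 = det N - (x + 1) phi0. *)

Set Implicit Arguments.
Unset Strict Implicit.
Unset Printing Implicit Defensive.

Import Order.TTheory GRing.Theory.

Local Open Scope ring_scope.

(** * The determinant of a matrix with a multiplied row and column *)

Section Determinants.

(** Rows and columns are permuted by the same permutation, so its sign occurs
    twice and disappears. *)
Lemma det_reindex (R : comNzRingType) (T : finType) (F : T -> T -> R)
    m (h : 'I_m -> T) : bijective h ->
  \det (\matrix_(i < #|T|, j < #|T|) F (enum_val i) (enum_val j)) =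
  \det (\matrix_(i < m, j < m) F (h i) (h j)).
Proof.
move=> h_bij.
have e : m = #|T| by rewrite -(bij_eq_card h_bij) card_ord.
subst m.
have s_inj : injective (fun i => enum_rank (h i)).
  by move=> i j /enum_rank_inj /(bij_inj h_bij).
pose M := \matrix_(i < #|T|, j < #|T|) F (enum_val i) (enum_val j).
have -> : \matrix_(i, j) F (h i) (h j) =
    row_perm (perm s_inj) (col_perm (perm s_inj) M).
  by apply/matrixP => i j; rewrite !mxE !permE !enum_rankK.
rewrite row_permE col_permE !det_mulmx !det_perm odd_permV.
by rewrite mulrC -mulrA -signr_addb addbb mulr1.
Qed.

Lemma det_block_schur (F : fieldType) m n (M : 'M[F]_m) (B : 'M_(m, n))
    (C : 'M_(n, m)) (N : 'M_n) : \det M != 0 ->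
  \det (block_mx M B C N) = \det M * \det (N - C *m invmx M *m B).
Proof.
move=> M0.
have Mu : M \in unitmx by rewrite unitmxE unitfE.
have -> : block_mx M B C N =
    block_mx 1%:M 0 (C *m invmx M) 1%:M *m block_mx M B 0 (N - C *m invmx M *m B).
  rewrite mulmx_block !mul1mx !mul0mx !addr0 mulmxKV //.
  by rewrite addrC subrK.
by rewrite det_mulmx det_lblock det_ublock !det1 !mul1r.
Qed.

(** Both sides are the determinant of the matrix with blocks N, b, a, 1, computed
    by eliminating with the entry 1 and by eliminating with N. *)
Lemma det_sub_rank1 (F : fieldType) n (N : 'M[F]_n) (b : 'cV_n) (a : 'rV_n) :
  \det N != 0 -> \det (N - b *m a) = \det N - (a *m \adj N *m b) 0 0.
Proof.
move=> N0; have := @det_block_schur F n 1 N b a 1%:M N0.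
have -> : block_mx N b a 1%:M =
    block_mx 1%:M b 0 1%:M *m block_mx (N - b *m a) 0 a 1%:M.
  rewrite mulmx_block !mul1mx !mul0mx !mulmx1 !add0r subrK.
  by [].
rewrite det_mulmx det_lblock det_ublock !det1 !mul1r mulr1 => ->.
set s := a *m invmx N *m b; rewrite [\det (1%:M - s)]det_mx11.
have -> : (1%:M - s) 0 0 = 1 - s 0 0 by rewrite !mxE.
rewrite mulrBr mulr1; congr (_ - _).
have Nu : N \in unitmx by rewrite unitmxE unitfE.
by rewrite /s /invmx Nu -scalemxAr -scalemxAl [in LHS]mxE mulrA mulfV // mul1r.
Qed.

Lemma det_cross_field (F : fieldType) m n (M : 'M[F]_m) (N : 'M_n)
    (u : 'cV_m) (w : 'rV_m) (a : 'rV_n) (b : 'cV_n) :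
  \det M != 0 -> \det N != 0 ->
  \det (block_mx M (u *m a) (b *m w) N) =
    \det M * \det N - (w *m \adj M *m u) 0 0 * (a *m \adj N *m b) 0 0.
Proof.
move=> M0 N0; rewrite det_block_schur //.
set s := w *m invmx M *m u.
have -> : b *m w *m invmx M *m (u *m a) = (s 0 0 *: b) *m a.
  by rewrite mulmxA -2!(mulmxA b) -/s [in LHS](mx11_scalar s) mul_mx_scalar.
rewrite det_sub_rank1 // mulrBr -scalemxAr; congr (_ - _).
rewrite mxE.
have Mu : M \in unitmx by rewrite unitmxE unitfE.
rewrite mulrA; congr (_ * _); rewrite /s /invmx Mu -scalemxAr -scalemxAl.
by rewrite [in LHS]mxE mulrA mulfV // mul1r.
Qed.

(** Over a field, with M and N invertible, this is [det_cross_field]. In general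
    M and N are replaced by 'X + M and 'X + N, whose determinants are monic and
    hence nonzero in the field of fractions; then 'X is specialised to 0. *)
Lemma det_cross (R : idomainType) m n (M : 'M[R]_m) (N : 'M_n)
    (u : 'cV_m) (w : 'rV_m) (a : 'rV_n) (b : 'cV_n) :
  \det (block_mx M (u *m a) (b *m w) N) =
    \det M * \det N - (w *m \adj M *m u) 0 0 * (a *m \adj N *m b) 0 0.
Proof.
pose ev : {rmorphism {poly R} -> R} := horner_eval 0.
(* The characteristic matrix of - A is 'X + A. *)
pose gen k (A : 'M[R]_k) : 'M[{poly R}]_k := char_poly_mx (- A).
have genE k (A : 'M[R]_k) : map_mx ev (gen k A) = A.
  by apply/matrixP => i j; rewrite !mxE /ev /= /horner_eval
     !(hornerE, hornerMn) mul0rn sub0r opprK.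
have gen_det k (A : 'M[R]_k) : \det (map_mx (tofrac (R := {poly R})) (gen k A)) != 0.
  by rewrite det_map_mx tofrac_eq0 monic_neq0 // char_poly_monic.
pose c k l (A : 'M[R]_(k, l)) := map_mx polyC A.
have cE k l (A : 'M[R]_(k, l)) : map_mx ev (c k l A) = A.
  by apply/matrixP => i j; rewrite !mxE /ev /= /horner_eval hornerC.
have key := det_cross_field (map_mx (@tofrac _) (c _ _ u))
  (map_mx (@tofrac _) (c _ _ w)) (map_mx (@tofrac _) (c _ _ a))
  (map_mx (@tofrac _) (c _ _ b)) (gen_det m M) (gen_det n N).
rewrite -!map_mxM -map_block_mx -!map_mx_adj -!map_mxM !det_map_mx in key.
rewrite ![map_mx _ _ 0 0]mxE -!rmorphM -rmorphB in key.
move/eqP: key; rewrite tofrac_eq => /eqP/(congr1 ev).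
rewrite rmorphB !rmorphM -!det_map_mx map_block_mx !map_mxM !cE !genE => ->.
have evE k l (A : 'M[{poly R}]_(k, l)) i j :
  ev (A i j) = map_mx ev A i j by rewrite mxE.
by rewrite !evE !map_mxM !map_mx_adj !cE !genE.
Qed.

Lemma det_border (R : idomainType) m (M : 'M[R]_m) (u : 'cV_m) (w : 'rV_m) c :
  \det (block_mx M u w (c%:M : 'M_1)) = \det M * c - (w *m \adj M *m u) 0 0.
Proof.
have := det_cross M (c%:M : 'M_1) u w 1%:M 1%:M.
rewrite mulmx1 mul1mx => ->; rewrite det_scalar1; congr (_ - _).
rewrite mulmx1 mul1mx [X in _ * X]mxE /cofactor det_mx00 addnn.
by rewrite -signr_odd odd_double !mulr1.
Qed.

(** The scalar w adj(M) u is all that either determinant keeps of the borders u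
    and w, and it is eliminated between [det_cross] and [det_border]. *)
Lemma det_insert (R : idomainType) m n (M : 'M[R]_m) (N : 'M_n)
    (u : 'cV_m) (w : 'rV_m) c :
  let k := \sum_i \sum_j (\adj N) i j in
  \det (block_mx M (u *m const_mx 1) (const_mx 1 *m w) N) =
    \det (block_mx M u w (c%:M : 'M_1)) * k + \det M * (\det N - c * k).
Proof.
move=> k; rewrite det_cross det_border.
have -> : (const_mx 1 *m \adj N *m const_mx 1 : 'M_1) 0 0 = k.
  rewrite mxE /k exchange_big; apply: eq_bigr => j _; rewrite !mxE mulr1.
  by apply: eq_bigr => i _; rewrite mxE mul1r.
by ring.
Qed.
End Determinants.

(** * Hom spaces as Peirce components *)

Section Dimension.
Local Open Scope classical_set_scope.
Variable K : fieldType.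

(** The map f factors through g by the matrix whose rows are preimages under g
    of the images of the basis vectors; it has independent rows. *)
Lemma dimension_le (V : lmodType K) n m (f : {linear 'rV[K]_n -> V})
    (g : {linear 'rV[K]_m -> V}) :
  injective f -> range f `<=` range g -> (n <= m)%N.
Proof.
move=> f_inj fg.
have /choice[r rE] i : exists y, g y = f (delta_mx 0 i).
  by have [y _ <-] := fg _ (imageT f (delta_mx 0 i)); exists y.
pose M := \matrix_(i < n) r i.
have gM x : g (x *m M) = f x.
  rewrite mulmx_sum_row [in RHS](row_sum_delta x) !linear_sum.
  by apply: eq_bigr => i _; rewrite !linearZ rowK rE.
suff /eqP <- : row_free M by exact: rank_leq_col.
rewrite -kermx_eq0; apply/eqP/row_matrixP => i; rewrite row0; apply: f_inj.
by rewrite -gM linear0 -row_mul mulmx_ker row0 linear0.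
Qed.

Lemma dimension_eq (V : lmodType K) (U : set V) n (f : {linear 'rV[K]_n -> V}) :
  injective f -> range f = U -> dimension U = n.
Proof.
move=> f_inj fU; rewrite /dimension; case: xgetP => [m _ /= [g [g_inj gU]]|no].
  apply/eqP; rewrite eqn_leq.
  by rewrite (dimension_le g_inj (g := f)) ?(dimension_le f_inj (g := g)) // ?gU ?fU.
by have /= := no n; case; exists f.
Qed.

Definition linear_on (V W : lmodType K) (U : set V) (g : V -> W) :=
  forall a x y, U x -> U y -> g (a *: x + y) = a *: g x + g y.

Lemma dimension_sub (V W : lmodType K) (U : set V) (U' : set W)
    (g : V -> W) (h : W -> V) :
  linear_on U g -> (forall x, U x -> U' (g x)) ->
  (forall y, U' y -> U (h y)) ->
  (forall x, U x -> h (g x) = x) -> (forall y, U' y -> g (h y) = y) ->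
  forall n, (exists f : {linear 'rV[K]_n -> V}, injective f /\ range f = U) ->
  exists f : {linear 'rV[K]_n -> W}, injective f /\ range f = U'.
Proof.
move=> gl gU hU hg gh n [f [f_inj fU]].
have Uf x : U (f x) by rewrite -fU; exact: imageT.
have gf_lin : linear (g \o f) by move=> a x y; rewrite /= linearP gl.
pose gfM := GRing.isLinear.Build _ _ _ _ (g \o f) gf_lin.
pose gf : {linear 'rV[K]_n -> W} := HB.pack (g \o f) gfM.
exists gf; split=> [x y exy|].
  apply: f_inj; rewrite -(hg _ (Uf x)) -(hg _ (Uf y)).
  by congr h.
apply/seteqP; split=> [_ [x _ <-]|y U'y]; first exact/gU/Uf.
have := hU _ U'y; rewrite -fU => -[x _ fx]; exists x => //=.
by rewrite fx gh.
Qed.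

(** The possible dimensions of the two subspaces form the same set, so the values
    also agree when that set is empty. *)
Lemma dimension_iso (V W : lmodType K) (U : set V) (U' : set W)
    (g : V -> W) (h : W -> V) :
  linear_on U g -> linear_on U' h ->
  (forall x, U x -> U' (g x)) -> (forall y, U' y -> U (h y)) ->
  (forall x, U x -> h (g x) = x) -> (forall y, U' y -> g (h y) = y) ->
  dimension U = dimension U'.
Proof.
move=> gl hl gU hU hg gh; rewrite /dimension; congr xget.
apply/seteqP; split=> n /=; first exact: (dimension_sub gl gU hU hg gh).
exact: (dimension_sub hl hU gU gh hg).
Qed.

End Dimension.

Section Peirce.
Local Open Scope classical_set_scope.
Variable K : fieldType.

(** For idempotents e and e' this is e' A e. *)
Definition peirce (A : kalgebra K) (e' e : A) : set A := [set x | e' * x * e = x].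

(** A homomorphism from e A is determined by the image of e, which can be any
    element of e' A e. *)
Lemma hom_dim_peirce (A : kalgebra K) (e e' : A) :
  e * e = e -> e' * e' = e' -> hom_dim e e' = dimension (peirce e' e).
Proof.
move=> ee ee'.
have e_rmod : e \in rmod_pred e by apply/rmod_predP; exists 1; rewrite mulr1.
pose e1 : rmod e := Sub e e_rmod.
have rmodl (u : A) (uu : u * u = u) (x : rmod u) : u * val x = val x.
  by have /rmod_predP[a ->] := valP x; rewrite mulrA uu.
have mulP (x : A) (y : rmod e) : e' * x * val y \in rmod_pred e'.
  by apply/rmod_predP; exists (x * val y); rewrite mulrA.
pose g (f : rmod e -> rmod e') : A := val (f e1).
pose h (x : A) (y : rmod e) : rmod e' := Sub (e' * x * val y) (mulP x y).
apply: (dimension_iso (g := g) (h := h)).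
- by move=> a f f' _ _; rewrite /g /=.
- move=> a x y _ _; apply/funext => z; apply: val_inj.
  transitivity (e' * (a *: x + y) * val z) => //.
  transitivity (a *: (e' * x * val z) + e' * y * val z) => //.
  by rewrite mulrDr mulrDl -kalg_scaleAr -kalg_scaleAl.
- move=> f [_ fM]; rewrite /peirce /= /g rmodl //.
  rewrite -[LHS]/(val (ract (f e1) e)) -fM; congr (val (f _)).
  by apply: val_inj; rewrite /= ee.
- move=> x; rewrite /peirce /= => xE; split=> [y z|y a]; apply: val_inj.
    by rewrite /= mulrDr.
  by rewrite /= mulrA.
- move=> f [fD fM]; apply/funext => y; apply: val_inj; rewrite /= /g rmodl //.
  rewrite -[LHS]/(val (ract (f e1) (val y))) -fM; congr (val (f _)).
  by apply: val_inj; rewrite /= rmodl.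
- by move=> x; rewrite /peirce /= /g /=.
Qed.

End Peirce.

(** * Path algebras and maps between Peirce components *)

Section QuiverPaths.
Variable Q : quiver.
Implicit Types p q r : qpath Q.

Lemma qpath_inj p q : pstart p = pstart q -> parrows p = parrows q -> p = q.
Proof. by move=> es ea; apply: val_inj; rewrite !qpath_valE es ea. Qed.

Lemma qpath_chainE p : chain (pstart p) (parrows p).
Proof. exact: qpath_chain. Qed.

Lemma qpath_exists x w : chain x w -> exists p, pstart p = x /\ parrows p = w.
Proof. by move=> xw; exists (@QPath Q (x, w) xw). Qed.

End QuiverPaths.

Section PathIdeals.
Variables (K : fieldType) (Q : quiver) (I : ideal (path_algebra K Q)).
Local Notation KQ := (path_ring K Q).
Local Notation "[ r ]" := (pelt K r : KQ).
Implicit Types (p q r : qpath Q) (x y z a : KQ).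

Lemma pelt_pprod p q : [p] * [q] = pprod K p q.
Proof. by rewrite /GRing.mul /= /path_mul /pelt !lextU. Qed.

Lemma peltM p q : pend p = pstart q -> exists r, [/\ [p] * [q] = [r],
  pstart r = pstart p, pend r = pend q & parrows r = parrows p ++ parrows q].
Proof.
move=> /pcompS[r [pq rE rs re]]; exists r; split=> //.
  by rewrite pelt_pprod /pprod pq.
by rewrite /parrows rE.
Qed.

Lemma peltM0 p q : pend p != pstart q -> [p] * [q] = 0.
Proof. by move=> ne; rewrite pelt_pprod /pprod pcompN. Qed.

Lemma pelt_trivl i p : [ptriv i] * [p] = if pstart p == i then [p] else 0.
Proof.
rewrite pelt_pprod /pprod pcomp_ptrivl eq_sym; by case: eqP.
Qed.

Lemma pelt_trivr p i : [p] * [ptriv i] = if pend p == i then [p] else 0.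
Proof. by rewrite pelt_pprod /pprod pcomp_ptrivr; case: eqP. Qed.

Lemma pelt_split r w1 w2 : parrows r = w1 ++ w2 -> exists r1 r2,
  [/\ pstart r1 = pstart r /\ parrows r1 = w1, pend r1 = pstart r2 /\ parrows r2 = w2,
      pend r2 = pend r & [r] = [r1] * [r2]].
Proof.
move=> rw; have := qpath_chainE r; rewrite rw chain_cat => /andP[c1 c2].
have [r1 [s1 a1]] := qpath_exists c1; have [r2 [s2 a2]] := qpath_exists c2.
have e12 : pend r1 = pstart r2 by rewrite /pend a1 s1 s2.
have [r' [r'E s' e' a']] := peltM e12.
have rr' : r = r' by apply: qpath_inj; rewrite ?s' ?a' ?s1 // a1 a2.
by exists r1, r2; split=> //; rewrite rr'.
Qed.

Lemma idealI0 : I (0 : KQ).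
Proof. by have [] := idealP I. Qed.

Lemma idealID x y : I x -> I y -> I (x + y).
Proof. by have [_ + _ _] := idealP I; exact. Qed.

Lemma idealIMl a x : I x -> I (a * x).
Proof. by have [_ _ + _] := idealP I; exact. Qed.

Lemma idealIMr a x : I x -> I (x * a).
Proof. by have [_ _ _ +] := idealP I; exact. Qed.

Lemma idealIN x : I x -> I (- x).
Proof. by move=> Ix; rewrite -mulN1r; exact: idealIMl. Qed.

Lemma idealIZ (c : K) x : I x -> I (c *: x).
Proof. by move=> Ix; rewrite -[x]mul1r path_scaleAl; exact: idealIMl. Qed.

Lemma ideal_congD x y : I (x - y) -> I y -> I x.
Proof. by move=> Ixy Iy; rewrite -(subrK y x); exact: idealID. Qed.

Lemma idealI_eq x y : x = y -> I (x - y).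
Proof. by move=> ->; rewrite subrr; exact: idealI0. Qed.

Lemma ideal_lext (P : choiceType) (F : P -> KQ) (f : {malg K[P]}) :
  (forall k, k \in msupp f -> I (F k)) -> I (lext F f).
Proof.
move=> IF; rewrite /lext big_seq; apply: big_ind => //.
- exact: idealI0.
- exact: idealID.
- by move=> k /IF; exact: idealIZ.
Qed.

Lemma mul_lextr (P : choiceType) a (F : P -> KQ) (f : {malg K[P]}) :
  a * lext F f = lext (fun k => a * F k) f.
Proof.
by rewrite /lext mulr_sumr; apply: eq_bigr => p _; rewrite -path_scaleAr.
Qed.

Lemma mul_lextl (P : choiceType) a (F : P -> KQ) (f : {malg K[P]}) :
  lext F f * a = lext (fun k => F k * a) f.
Proof.
by rewrite /lext mulr_suml; apply: eq_bigr => p _; rewrite -path_scaleAl.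
Qed.

Lemma lext_pelt x : lext (fun p => [p]) x = x.
Proof. exact: lext_id. Qed.

Lemma lextB_F (P : choiceType) (F G : P -> KQ) (f : {malg K[P]}) :
  lext F f - lext G f = lext (fun k => F k - G k) f.
Proof.
rewrite /lext -sumrB; apply: eq_bigr => p _; by rewrite scalerBr.
Qed.

(** Two scalings meet here, c *: z of the path ring and (c *: 1) * z of the
    algebra built on it; they are equal without being convertible. *)
Lemma quot_piZ (c : K) x :
  quot_pi I (c *: x : KQ) = c *: (quot_pi I x : quot_algebra I).
Proof.
rewrite kalg_scaleE /=; transitivity (quot_pi I (path_scalar Q c * x)).
  by congr quot_pi; rewrite /path_scalar -path_scaleAl mul1r.
exact: rmorphM.
Qed.

Lemma quot_piMr x y : quot_pi I (x * y) = (quot_pi I x : quot_algebra I) * quot_pi I y.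
Proof. exact: rmorphM. Qed.

Lemma peirce_pathE (i j : vert Q) x :
  [ptriv i] * x * [ptriv j] =
  lext (fun p => if (pstart p == i) && (pend p == j) then [p] else 0) x.
Proof.
rewrite -{1}(lext_pelt x) mul_lextr mul_lextl; apply: eq_lext => p.
by rewrite pelt_trivl; case: eqP => _; rewrite ?mul0r //= pelt_trivr.
Qed.

Lemma vertex_idem_mul i j x :
  vertex_idem I i * (quot_pi I x : quot_algebra I) * vertex_idem I j =
  quot_pi I ([ptriv i] * x * [ptriv j]).
Proof. by rewrite !quot_piMr. Qed.

End PathIdeals.

Section Transport.
Variables (K : fieldType) (Q Q' : quiver).

(** A map on paths acts on a single Peirce component. Extending it by 0 to the
    other ones gives a total linear map, defined without subspaces. *)
Definition corner_ext (i j : vert Q) (c : qpath Q -> qpath Q') :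
    path_ring K Q -> path_ring K Q' :=
  lext (fun p => if (pstart p == i) && (pend p == j)
                 then (pelt K (c p) : path_ring K Q') else 0).

HB.instance Definition _ i j c := GRing.Linear.on (corner_ext i j c).

Lemma corner_ext_pelt i j c p : corner_ext i j c (pelt K p) =
  if (pstart p == i) && (pend p == j) then (pelt K (c p) : path_ring K Q') else 0.
Proof. by rewrite /corner_ext /pelt lextU. Qed.

Lemma corner_ext0 i j c : corner_ext i j c 0 = 0.
Proof. exact: linear0. Qed.

Lemma corner_extD i j c z z' :
  corner_ext i j c (z + z') = corner_ext i j c z + corner_ext i j c z'.
Proof. exact: linearD. Qed.

Lemma corner_extB i j c z z' :
  corner_ext i j c (z - z') = corner_ext i j c z - corner_ext i j c z'.
Proof. exact: linearB. Qed.

Lemma corner_ext_lext i j c (P : choiceType) (F : P -> path_ring K Q)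
    (f : {malg K[P]}) :
  corner_ext i j c (lext F f) = lext (fun k => corner_ext i j c (F k)) f.
Proof. exact: (linear_lext (corner_ext i j c)). Qed.

Lemma corner_extE i j c z : corner_ext i j c z =
  corner_ext i j c ((pelt K (ptriv i) : path_ring K Q) * z * pelt K (ptriv j)).
Proof.
rewrite peirce_pathE linear_lext; apply: eq_lext => p /=.
by case: ifP => e; rewrite ?linear0 // corner_ext_pelt e.
Qed.

End Transport.

Section PeirceTransport.
Variables (K : fieldType) (Q Q' : quiver).
Variables (I : ideal (path_algebra K Q)) (I' : ideal (path_algebra K Q')).
Variables (x y : vert Q) (x' y' : vert Q').
Variables (c : qpath Q -> qpath Q') (l : qpath Q' -> qpath Q).
Local Notation "[ r ]" := (pelt K r : path_ring K _).

Lemma corner_ext_comp :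
  (forall p, pstart p = x -> pend p = y -> pstart (c p) = x' /\ pend (c p) = y') ->
  (forall p, pstart p = x -> pend p = y -> I ([p] - [l (c p)])) ->
  forall z, I ([ptriv x] * z * [ptriv y] - corner_ext x' y' l (corner_ext x y c z)).
Proof.
move=> cE lc z; rewrite peirce_pathE [corner_ext x y c z]/corner_ext.
rewrite (linear_lext (corner_ext x' y' l)) lextB_F.
apply: ideal_lext => p _ /=.
case: ifP => [/andP[/eqP ps /eqP pe]|_]; last by rewrite linear0 subr0; exact: idealI0.
have [cs ce] := cE p ps pe.
by rewrite corner_ext_pelt cs ce !eqxx; exact: lc.
Qed.

End PeirceTransport.

(** The last two assumptions make the linear extensions of c and l well defined
    on the quotients, the two before them make these maps inverse to each other. *)
Lemma peirce_iso (K : fieldType) (Q Q' : quiver)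
    (I : ideal (path_algebra K Q)) (I' : ideal (path_algebra K Q'))
    (x y : vert Q) (x' y' : vert Q')
    (c : qpath Q -> qpath Q') (l : qpath Q' -> qpath Q) :
  (forall p, pstart p = x -> pend p = y -> pstart (c p) = x' /\ pend (c p) = y') ->
  (forall p, pstart p = x' -> pend p = y' -> pstart (l p) = x /\ pend (l p) = y) ->
  (forall p, pstart p = x -> pend p = y ->
    I ((pelt K p : path_ring K Q) - pelt K (l (c p)))) ->
  (forall p, pstart p = x' -> pend p = y' ->
    I' ((pelt K p : path_ring K Q') - pelt K (c (l p)))) ->
  (forall z, I z -> I' (corner_ext x y c z)) ->
  (forall z, I' z -> I (corner_ext x' y' l z)) ->
  dimension (peirce (vertex_idem I x) (vertex_idem I y)) =
  dimension (peirce (vertex_idem I' x') (vertex_idem I' y')).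
Proof.
move=> cE lE lc cl cI lI.
have lin (Q1 Q2 : quiver) (I1 : ideal (path_algebra K Q1))
    (I2 : ideal (path_algebra K Q2)) i j (f : qpath Q1 -> qpath Q2) :
    (forall z, I1 z -> I2 (corner_ext i j f z)) ->
    exists g : quot_algebra I1 -> quot_algebra I2,
     (forall z, g (quot_pi I1 z) = quot_pi I2 (corner_ext i j f z)) /\
     linear g.
  move=> fI; pose g (X : quot_algebra I1) : quot_algebra I2 :=
    quot_pi I2 (corner_ext i j f (repr X)).
  have gE z : g (quot_pi I1 z) = quot_pi I2 (corner_ext i j f z).
    by apply/quot_piE; rewrite -linearB; apply: fI; exact: quot_repr.
  exists g; split=> // a X Y.
  have [u ->] := quot_pi_surj X; have [t ->] := quot_pi_surj Y.
  rewrite -quot_piZ -[_ + _](quot_piD I1) !gE linearP quot_piD.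
  by rewrite quot_piZ.
have [g [gE gl]] := lin _ _ _ _ _ _ _ cI.
have [h [hE hl]] := lin _ _ _ _ _ _ _ lI.
have hg X : h (g X) = vertex_idem I x * X * vertex_idem I y.
  have [z ->] := quot_pi_surj X; rewrite vertex_idem_mul gE hE; apply/esym/quot_piE.
  exact: corner_ext_comp cE lc z.
have gh X : g (h X) = vertex_idem I' x' * X * vertex_idem I' y'.
  have [z ->] := quot_pi_surj X; rewrite vertex_idem_mul hE gE; apply/esym/quot_piE.
  exact: corner_ext_comp lE cl z.
apply: (dimension_iso (g := g) (h := h)).
- by move=> a X Y _ _; exact: gl.
- by move=> a X Y _ _; exact: hl.
- by move=> X; rewrite /peirce /= => XE; rewrite -gh hg XE.
- by move=> X; rewrite /peirce /= => XE; rewrite -hg gh XE.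
- by move=> X; rewrite /peirce /= => XE; rewrite hg XE.
- by move=> X; rewrite /peirce /= => XE; rewrite gh XE.
Qed.

(** * Corners and the smallest Peirce components *)

Section CornerHom.
Variables (K : fieldType) (A : idem_algebra K) (v : ia_vert A).

Lemma ia_idemK (B : idem_algebra K) (i : ia_vert B) : ia_idem i * ia_idem i = ia_idem i.
Proof. by rewrite ia_orth eqxx. Qed.

Local Notation C := (corner_ring (idem_complK v)).

Lemma hom_dim_corner (i j : {i | i != v}) :
  hom_dim (corner_idem i) (corner_idem j) = hom_dim (ia_idem (val i)) (ia_idem (val j)).
Proof.
rewrite !hom_dim_peirce ?ia_idemK ?corner_idem_orth ?eqxx //.
set f := 1 - ia_idem v.
have valZ (a : K) (X : corner_algebra (idem_complK v)) :
    val (a *: X : C) = a *: val (X : C).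
  transitivity (f * kalg_scalar (ia_alg A) a * val (X : C)) => //.
  by rewrite -kalg_central -mulrA corner_fl.
pose h (x : ia_alg A) : C := insubd (0 : C) x.
have hK x : peirce (ia_idem (val j)) (ia_idem (val i)) x -> val (h x) = x.
  move=> xE; rewrite /h; apply: insubdK.
  rewrite /peirce /= in xE.
  apply/corner_predP; exists x; rewrite -{2}xE.
  rewrite -{1}xE -(idem_compl_mul (valP i)) -(idem_compl_mul (valP j)) -/f.
  have ff : f * f = f by exact: idem_complK.
  by rewrite !mulrA ff -!mulrA ff.
apply: (@dimension_iso K (corner_algebra (idem_complK v)) (ia_alg A) _ _
  (val : C -> ia_alg A) h).
- by move=> a X Y _ _; rewrite -valZ.
- move=> a x y Px Py; apply: val_inj; rewrite hK.
    transitivity (a *: val (h x) + val (h y)); first by rewrite !hK.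
    by rewrite -valZ.
  move: Px Py; rewrite /peirce /= => xE yE.
  by rewrite mulrDr mulrDl -kalg_scaleAr -kalg_scaleAl xE yE.
- by move=> X; rewrite /peirce /= => XE; rewrite -[RHS](congr1 val XE).
- move=> x xP; apply: val_inj; rewrite [RHS]hK //.
  transitivity (ia_idem (val j) * val (h x) * ia_idem (val i)) => //.
  by rewrite hK.
- move=> X XE; apply: val_inj; rewrite hK //.
  by rewrite /peirce /= -[RHS](congr1 val XE).
- by move=> x; exact: hK.
Qed.

End CornerHom.

Section SmallPeirce.
Variables (K : fieldType) (Q : quiver) (I : ideal (path_algebra K Q)).
Local Notation "[ r ]" := (pelt K r : path_ring K Q).

Lemma lext_single (V : lmodType K) (t : qpath Q) (F : V) (z : path_ring K Q) :
  lext (fun p => if p == t then F else 0) z = z@_t *: F.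
Proof.
rewrite /lext; have [tz|/mcoeff_outdom t0] := boolP (t \in msupp z); last first.
  rewrite t0 scale0r big1_seq // => p /andP[_ pz].
  by case: eqP => [pt|_]; rewrite ?scaler0 // pt t0 scale0r.
rewrite (bigD1_seq t) ?fset_uniq //= eqxx big1 ?addr0 // => p /negPf ->.
by rewrite scaler0.
Qed.

Lemma dimension_no_path i j :
  (forall p : qpath Q, pstart p = i -> pend p = j -> False) ->
  dimension (peirce (vertex_idem I i) (vertex_idem I j)) = 0%N.
Proof.
move=> no; apply: (@dimension_eq _ _ _ 0 (\0 : {linear 'rV[K]_0 -> _})).
  by move=> x y _; rewrite [x]thinmx0 [y]thinmx0.
apply/seteqP; split=> [_ [x _ <-]|X]; rewrite /peirce /=.
  by rewrite mulr0 mul0r.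
have [z ->] := quot_pi_surj X; rewrite vertex_idem_mul peirce_pathE.
set w := lext _ _; have -> : w = 0.
  rewrite -[RHS](lext0F _ z); apply: eq_lext => p.
  by case: ifP => // /andP[/eqP pi /eqP pj]; case: (no p).
by move=> <-; exists 0 => //; exact/esym/(rmorph0 (quot_pi I)).
Qed.

(** The only path from v to v is the trivial one, so this component is spanned by
    the class of e_v, which is not 0 because no element of I involves it. *)
Lemma dimension_vertex v :
  acyclic Q -> (forall z : path_ring K Q, I z -> z@_(ptriv v) = 0) ->
  dimension (peirce (vertex_idem I v) (vertex_idem I v)) = 1%N.
Proof.
move=> acQ I0.
pose f0 (r : 'rV[K]_1) : quot_algebra I := r 0 0 *: vertex_idem I v.
have fl : linear f0.
  by move=> a x y; rewrite /f0 !mxE scalerDl scalerA.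
pose fM := GRing.isLinear.Build _ _ _ _ f0 fl.
pose f : {linear 'rV[K]_1 -> quot_algebra I} := HB.pack f0 fM.
apply: (@dimension_eq _ _ _ 1 f) => [x y|].
  move=> fxy; have exy : x 0 0 *: vertex_idem I v = y 0 0 *: vertex_idem I v := fxy.
  have /I0 : I (x 0 0 *: [ptriv v] - y 0 0 *: [ptriv v] : path_ring K Q).
    apply/(quot_piE I _ _).1.
    exact: etrans (quot_piZ I _ _) (etrans exy (esym (quot_piZ I _ _))).
  rewrite -scalerBl mcoeffZ mcoeffUU mulr1 => /subr0_eq e.
  by apply/matrixP => i j; rewrite !ord1.
apply/seteqP; split=> [_ [x _ <-]|X]; rewrite /peirce.
  have -> : f x = x 0 0 *: vertex_idem I v by [].
  rewrite /= -kalg_scaleAr -kalg_scaleAl !vertex_idem_orth eqxx.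
  by rewrite vertex_idem_orth eqxx.
have [z ->] := quot_pi_surj X; rewrite /= vertex_idem_mul peirce_pathE => XE.
exists (z@_(ptriv v))%:M; [by []|apply: etrans XE].
have fE : f (z@_(ptriv v))%:M = z@_(ptriv v) *: vertex_idem I v.
  by rewrite /f /= /f0 mxE eqxx mulr1n.
apply: etrans fE _; apply: etrans (esym (quot_piZ I _ _)) _.
apply: (congr1 (quot_pi I)).
apply: etrans (esym (@lext_single (path_ring K Q) (ptriv v) [ptriv v] z)) _.
apply: eq_lext => p.
case: eqP => [-> |ne]; first by rewrite /pend /pstart /= eqxx.
case: ifP => // /andP[/eqP ps /eqP pe]; case: ne.
apply: qpath_inj; rewrite ?ps //; apply: acQ; by rewrite ps pe.
Qed.

End SmallPeirce.

Section TriIdeal.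
Local Open Scope classical_set_scope.
Variables (K : fieldType).

Lemma ideal_gen_sub (A : kalgebra K) (G J : set A) :
  two_sided_ideal J -> G `<=` J -> forall z, ideal_gen G z -> J z.
Proof. by move=> Ji GJ z; apply; split. Qed.

Lemma ideal_gen_in (A : kalgebra K) (G : set A) z : G z -> ideal_gen G z.
Proof. by move=> Gz J [_]; apply. Qed.

Lemma pprod_triv (Q : quiver) (p q : qpath Q) i :
  (pprod K p q)@_(ptriv i) != 0 -> p = ptriv i /\ q = ptriv i.
Proof.
rewrite /pprod; have [e|ne] := eqVneq (pend p) (pstart q); last first.
  by rewrite pcompN //= mcoeff0 eqxx.
have [r [-> rE _ _]] := pcompS e; rewrite /= mcoeffU.
case: (r =P ptriv i) => [ri _|_]; last by rewrite mulr0n eqxx.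
have [ps pa] : pstart p = i /\ parrows p ++ parrows q = [::].
  move: rE; rewrite ri => rE.
  by split; [exact: esym (congr1 fst rE)|exact: esym (congr1 snd rE)].
have [p0 q0] : parrows p = [::] /\ parrows q = [::].
  by case: (parrows p) pa => //= ->.
split; apply: qpath_inj => //.
by rewrite -e /pend p0.
Qed.

Lemma path_coeffZ (Q : quiver) (a : K) (x : path_ring K Q) t :
  (a *: x : path_ring K Q)@_t = a * x@_t.
Proof. exact: mcoeffZ. Qed.

Lemma mulr_triv_eq0 (Q : quiver) (x y : path_ring K Q) i :
  x@_(ptriv i) = 0 \/ y@_(ptriv i) = 0 -> (x * y)@_(ptriv i) = 0.
Proof.
move=> xy0; rewrite /GRing.mul /= /path_mul /lext raddf_sum big1 // => p _.
rewrite /= path_coeffZ raddf_sum mulr_sumr big1 // => q _; rewrite /= path_coeffZ.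
have [->|/pprod_triv[pi qi]] := eqVneq (pprod K p q)@_(ptriv i) 0.
  by rewrite !mulr0.
by case: xy0; rewrite pi qi => ->; rewrite !(mul0r, mulr0).
Qed.

(** The coefficient of a trivial path is multiplicative, so it vanishes on an
    ideal; the relations lie in it because their paths have length at least 2. *)
Lemma tri_ideal_triv (L : triangular K) (z : path_ring K (tri_quiver L)) i :
  tri_ideal L z -> z@_(ptriv i) = 0.
Proof.
move=> Iz; pose J := [set z : path_ring K (tri_quiver L) | z@_(ptriv i) = 0].
apply: (@ideal_gen_sub (path_algebra K _) (tri_rels L) J _ _ z Iz).
  split=> [|x y|a x|a x] /=.
  - exact: mcoeff0.
  - move=> x0 y0; rewrite /J /=.
    by apply: etrans (mcoeffD _ (x : path_ring K _) y) _; rewrite x0 y0 addr0.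
  - by move=> x0; apply: mulr_triv_eq0; right.
  - by move=> x0; apply: mulr_triv_eq0; left.
move=> x /tri_rels_parallel[k [j xP]] /=; apply: mcoeff_outdom.
by apply/negP => /xP[].
Qed.
End TriIdeal.

(** * Words and paths in a finite poset *)

Section Words.

Lemma split_at_first (T : Type) (P : pred T) (s : seq T) :
  all (predC P) s \/ exists s1 a s2, [/\ s = s1 ++ a :: s2, all (predC P) s1 & P a].
Proof.
elim: s => [|b s [alls|[s1 [a [s2 [-> all1 Pa]]]]]]; first by left.
  have [Pb|nPb] := boolP (P b); first by right; exists [::], b, s.
  by left; rewrite /= nPb.
right; have [Pb|nPb] := boolP (P b); first by exists [::], b, (s1 ++ a :: s2).
by exists (b :: s1), a, s2; rewrite /= nPb.
Qed.

Lemma first_unique (T : Type) (P : pred T) s1 a s2 s1' a' s2' :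
  s1 ++ a :: s2 = s1' ++ a' :: s2' -> all (predC P) s1 -> all (predC P) s1' ->
  P a -> P a' -> [/\ s1 = s1', a = a' & s2 = s2'].
Proof.
elim: s1 s1' => [|b s1 IH] [|b' s1'] /=.
- by move=> [-> ->].
- by move=> [-> _] _ /andP[/negbTE->].
- by move=> [-> _] /andP[/negbTE->].
- move=> [-> e] /andP[_ n1] /andP[_ n1'] Pa Pa'.
  by have [-> -> ->] := IH _ e n1 n1' Pa Pa'.
Qed.

Lemma map_eq_cat (T U : Type) (f : T -> U) s w1 w2 : map f s = w1 ++ w2 ->
  exists s1 s2, [/\ s = s1 ++ s2, map f s1 = w1 & map f s2 = w2].
Proof.
move=> e; exists (take (size w1) s), (drop (size w1) s); split.
- by rewrite cat_take_drop.
- by rewrite map_take e take_size_cat.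
- by rewrite map_drop e drop_size_cat.
Qed.

End Words.

Section HassePaths.
Variables (d : Order.disp_t) (S : finPOrderType d).
Local Open Scope order_scope.
Implicit Types (s t u : S) (q : qpath (hasse S)).

Lemma minimal_below s : exists2 m, is_minimal m & m <= s.
Proof.
have [k] := ubnP #|[set t | t < s]|; elim: k s => // k IH s; rewrite ltnS => lek.
have [min_s|] := boolP (is_minimal s); first by exists s.
rewrite negb_forall => /existsP[t]; rewrite negbK => ts.
have [|m min_m mt] := IH t; last by exists m => //; exact: le_trans mt (ltW ts).
apply: leq_trans lek; apply/proper_card/properP; split.
  by apply/fintype.subsetP => u; rewrite !inE => /lt_trans; apply.
by exists t; rewrite !inE ?ltxx.
Qed.

Lemma maximal_above s : exists2 m, is_maximal m & s <= m.
Proof.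
have [k] := ubnP #|[set t | s < t]|; elim: k s => // k IH s; rewrite ltnS => lek.
have [max_s|] := boolP (is_maximal s); first by exists s.
rewrite negb_forall => /existsP[t]; rewrite negbK => st.
have [|m max_m tm] := IH t; last by exists m => //; exact: le_trans (ltW st) tm.
apply: leq_trans lek; apply/proper_card/properP; split.
  by apply/fintype.subsetP => u; rewrite !inE; exact: lt_trans.
by exists t; rewrite !inE ?ltxx.
Qed.

Lemma hasse_path_le q : pstart q <= pend q.
Proof.
have : chain (pstart q) (parrows q) by exact: qpath_chainE.
rewrite /pend; elim: (parrows q) (pstart q) => //= -[[s t] st] w IH x.
move=> /andP[/eqP <- /IH]; apply: le_trans; case/andP: (st) => /ltW.
by [].
Qed.

Lemma hasse_path s t : s <= t -> exists q, pstart q = s /\ pend q = t.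
Proof.
have [k] := ubnP #|[set u | s < u < t]|; elim: k s t => // k IH s t.
rewrite ltnS => lek.
rewrite le_eqVlt => /predU1P[->|st]; first by exists (@ptriv (hasse S) t).
have [cov|] := boolP (covered s t).
  have c : @chain (hasse S) s [:: exist _ (s, t) cov] by rewrite /= eqxx.
  have [q [qs qw]] := qpath_exists c; exists q; split=> //.
  by rewrite /pend qw.
rewrite negb_and st /= negb_forall => /existsP[u]; rewrite negbK => /andP[su ut].
have lt1 : (#|[set x : S | (s < x < u)%O]| < k)%N.
  apply: leq_trans lek; apply/proper_card/properP; split.
    apply/fintype.subsetP => x; rewrite !inE => /andP[-> xu].
    exact: lt_trans xu ut.
  by exists u; rewrite !inE ?ltxx ?andbF ?su.
have lt2 : (#|[set x : S | (u < x < t)%O]| < k)%N.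
  apply: leq_trans lek; apply/proper_card/properP; split.
    apply/fintype.subsetP => x; rewrite !inE => /andP[ux ->].
    by rewrite andbT; exact: lt_trans su ux.
  by exists u; rewrite !inE ?ltxx ?andbF ?su.
have [q [q1 q2]] := IH s u lt1 (ltW su).
have [q' [q1' q2']] := IH u t lt2 (ltW ut).
have [r [_ _ rs re]] := pcompS (etrans q2 (esym q1')).
by exists r; rewrite rs re.
Qed.

End HassePaths.

(** * Paths of the inserted quiver as words *)

Section InsertionWords.
Variables (K : fieldType) (L : triangular K) (v : vert (tri_quiver L)).
Variables (d : Order.disp_t) (S : finPOrderType d).
Local Notation Q := (tri_quiver L).
Local Notation Qi := (ins_quiver v S).
Local Notation V := (vert Q + S)%type.
Local Notation hw := (hasse_word L).
Local Notation Old := (@Old _ L _ S).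
Implicit Types (x y : V) (w m : seq (raw_arrow L S)) (u : seq (arr Q)).
Implicit Types (r : qpath Qi) (p : qpath Q).

(** Paths of the inserted quiver are studied as words of raw arrows, whose ends
    carry no proofs, so that words can be cut, joined and compared freely. *)
Fixpoint rchain x w : bool :=
  if w is a :: w' then [&& is_ins_arrow v a, raw_src a == x & rchain (raw_tgt a) w']
  else true.

Definition rend x w : V := last x [seq raw_tgt a | a <- w].

Lemma rend_cat x w1 w2 : rend x (w1 ++ w2) = rend (rend x w1) w2.
Proof. by rewrite /rend map_cat last_cat. Qed.

Lemma rchain_cat x w1 w2 : rchain x (w1 ++ w2) = rchain x w1 && rchain (rend x w1) w2.
Proof. by elim: w1 x => //= a w1 IH x; rewrite IH !andbA. Qed.

Definition word r : seq (raw_arrow L S) := [seq val a | a <- parrows r].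

Lemma rchain_word r : rchain (val (pstart r)) (word r).
Proof.
have := qpath_chainE r; rewrite /word.
elim: (parrows r) (pstart r) => //= a w IH x /andP[/eqP<- /IH /= ->].
by rewrite eqxx !andbT; exact: (valP a).
Qed.

Lemma rend_word r : val (pend r) = rend (val (pstart r)) (word r).
Proof.
rewrite /pend /rend /word -!map_comp.
by elim: (parrows r) (pstart r) => //= a w IH x; rewrite IH.
Qed.

Lemma spells_inj r r' x w : spells r x w -> spells r' x w -> r = r'.
Proof.
move=> [sx aw] [sx' aw']; apply: qpath_inj; first by apply: val_inj; rewrite sx.
by apply: (inj_map val_inj); rewrite aw.
Qed.

Lemma spells_exists x w : x != inl v -> rchain x w -> exists r, spells r x w.
Proof.
move=> xv xw.
suff [aw [c e]] : exists aw : seq (arr Qi),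
    chain (Sub x xv : vert Qi) aw /\ [seq val a | a <- aw] = w.
  have [r [rs ra]] := qpath_exists c; exists r; split; first by rewrite rs.
  by rewrite ra.
elim: w x xv xw => [|a w IH] x xv /=; first by exists [::].
move=> /and3P[ia /eqP ax /IH]; pose b : arr Qi := Sub a ia.
move=> /(_ (valP (tgt b)))[aw [c e]]; exists (b :: aw) => /=; rewrite e.
split=> //; apply/andP; split; first by rewrite -val_eqE /= ax.
by move: c; congr chain; apply: val_inj.
Qed.

Lemma spells_split r x w1 w2 : spells r x (w1 ++ w2) -> exists r1 r2,
  [/\ spells r1 x w1, spells r2 (rend x w1) w2 &
   (pelt K r : path_ring K Qi) = (pelt K r1 : path_ring K Qi) * pelt K r2].
Proof.
move=> [rx rw]; have [a1 [a2 [ra e1 e2]]] := map_eq_cat rw.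
have [r1 [r2 [[s1 p1] [s2 p2] _ rE]]] := @pelt_split K Qi r a1 a2 ra.
exists r1, r2; split=> //; split; rewrite ?s1 ?p1 ?p2 //.
by rewrite -s2 rend_word s1 rx /word p1 e1.
Qed.

Definition collapse_vertex x : vert Q := if x is inl i then i else v.

Definition collapse_arrow (a : raw_arrow L S) : option (arr Q) :=
  match a with
  | Defs.Old g => Some g
  | Hasse _ _ => None
  | In a _ => Some a
  | Out _ b => Some b
  end.

Definition collapse_word w : seq (arr Q) := pmap collapse_arrow w.

Lemma collapse_cat w1 w2 :
  collapse_word (w1 ++ w2) = collapse_word w1 ++ collapse_word w2.
Proof. exact: pmap_cat. Qed.

Lemma collapse_old u : collapse_word (map Old u) = u.
Proof. by elim: u => //= a u ->. Qed.

Lemma collapse_hasse (q : qpath (hasse S)) : collapse_word (hw q) = [::].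
Proof. by rewrite /hasse_word; elim: (parrows q). Qed.

Lemma chain_collapse x w : rchain x w -> chain (collapse_vertex x) (collapse_word w) /\
  last (collapse_vertex x) [seq tgt a | a <- collapse_word w] =
    collapse_vertex (rend x w).
Proof.
rewrite /rend; elim: w x => //= a w IH x /and3P[ia /eqP <- /IH[c e]].
case: a ia c e => [g|s s'|a s|s b] //= ia c e; rewrite ?eqxx ?c //.
  by case/andP: ia => /eqP -> _; rewrite ?eqxx c.
by case/andP: ia => /eqP -> _; rewrite eqxx.
Qed.

Lemma collapse_proof r :
  chain (collapse_vertex (val (pstart r))) (collapse_word (word r)).
Proof. by case: (chain_collapse (rchain_word r)). Qed.

(** The functor that contracts S to the vertex v. *)
Definition collapse r : qpath Q :=
  @QPath Q (collapse_vertex (val (pstart r)), collapse_word (word r))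
    (collapse_proof r).

Lemma pstart_collapse r : pstart (collapse r) = collapse_vertex (val (pstart r)).
Proof. by []. Qed.

Lemma parrows_collapse r : parrows (collapse r) = collapse_word (word r).
Proof. by []. Qed.

Lemma pend_collapse r : pend (collapse r) = collapse_vertex (val (pend r)).
Proof.
by have [_ e] := chain_collapse (rchain_word r); rewrite rend_word -e.
Qed.

Local Notation hits := (fun a : arr Q => tgt a == v).
Local Notation avoids := (all (predC hits)).

Lemma chain_loop i u : chain i u -> last i [seq tgt a | a <- u] = i -> u = [::].
Proof.
move=> c e; have [p [ps pu]] := qpath_exists c.
by rewrite -pu; apply: tri_acyclic; rewrite /pend ps pu e.
Qed.

(** Otherwise an initial segment would be a cycle at v. *)
Lemma avoids_out b u : chain v (b :: u) -> avoids (b :: u).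
Proof.
case: (split_at_first hits (b :: u)) => // -[u1 [a [u2 [-> _ /eqP av]]]].
rewrite -cat1s catA chain_cat => /andP[c _].
by have := chain_loop c; rewrite map_cat last_cat /= av => /(_ erefl); case: u1 {c}.
Qed.

(** Otherwise a final segment would be a cycle at v. *)
Lemma avoids_in i u a : chain i (rcons u a) -> tgt a = v -> avoids u.
Proof.
move=> c av; case: (split_at_first hits u) => // -[u1 [a1 [u2 [e _ /eqP a1v]]]].
move: c; rewrite e -cats1 -catA chain_cat /= a1v => /and3P[_ _ c].
have := chain_loop c; rewrite map_cat last_cat /= av => /(_ erefl).
by case: (u2).
Qed.

Lemma rchain_old i u : i != v -> chain i u -> avoids u -> rchain (inl i) (map Old u).
Proof.
elim: u i => //= a u IH i iv /andP[/eqP ai c] /andP[av uv].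
by rewrite ai eqxx iv av IH.
Qed.

Lemma rend_old i u : rend (inl i) (map Old u) = inl (last i [seq tgt a | a <- u]).
Proof. by rewrite /rend; elim: u i => //= a u IH i. Qed.

Lemma rchain_hasse (q : qpath (hasse S)) : rchain (inr (pstart q)) (hw q).
Proof.
have := qpath_chainE q; rewrite /hasse_word.
elim: (parrows q) (pstart q) => //= -[[s t] /= st] w IH x /andP[/eqP <- /IH ->].
by rewrite st eqxx.
Qed.

Lemma rend_hasse (q : qpath (hasse S)) : rend (inr (pstart q)) (hw q) = inr (pend q).
Proof.
rewrite /rend /hasse_word /pend -!map_comp.
by elim: (parrows q) (pstart q) => //= a w IH x; rewrite IH.
Qed.

Lemma shape_from_S s w : rchain (inr s) w -> exists q : qpath (hasse S),
  pstart q = s /\ (w = hw q \/ exists b w', [/\ is_maximal (pend q), src b = v,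
    w = hw q ++ Out (pend q) b :: w' & rchain (inl (tgt b)) w']).
Proof.
elim: w s => [|a w IH] s /=; first by exists (@ptriv (hasse S) s); split=> //; left.
case: a => [g|t t'|a t|t b] /and3P[] /= ia /eqP //.
- move=> [ts] /IH[q [qs qw]].
  pose h : arr (hasse S) := exist _ (t, t') ia.
  have c : @chain (hasse S) s (h :: parrows q).
    by rewrite /= ts eqxx -qs; exact: qpath_chainE.
  have [q' [q's q'a]] := qpath_exists c.
  have q'w : hw q' = Hasse L t t' :: hw q by rewrite /hasse_word q'a.
  have q'e : pend q' = pend q by rewrite /pend q'a q's /= qs.
  exists q'; split=> //; rewrite q'w q'e.
  by case: qw => [->|[b [w' [mx bv -> c']]]]; [left|right; exists b, w'].
- move=> [ts] c; case/andP: ia => /eqP bv mx; exists (@ptriv (hasse S) s).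
  by split=> //; right; exists b, w; rewrite -ts.
Qed.

Lemma shape_from_old i w : rchain (inl i) w ->
  (exists2 u, w = map Old u & avoids u) \/
  exists u a s w', [/\ w = map Old u ++ In a s :: w', avoids u, tgt a = v,
    is_minimal s & rchain (inr s) w'].
Proof.
elim: w i => [|a w IH] i /=; first by left; exists [::].
case: a => [g|t t'|a t|t b] /and3P[] /= ia /eqP //.
- move=> _; case/andP: ia => _ gv /IH[[u -> uv]|[u [a [s [w' [-> uv av ms c]]]]]].
    by left; exists (g :: u); rewrite //= gv.
  by right; exists (g :: u), a, s, w'; rewrite /= gv.
- move=> _ c; case/andP: ia => /eqP av mt; right; by exists [::], a, t, w.
Qed.

(** A path that leaves S and enters it again would collapse to a cycle at v. *)
Lemma shape_out s b w : rchain (inr s) (Out s b :: w) ->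
  exists2 u, w = map Old u & avoids u.
Proof.
move=> c0; have /= /and3P[/andP[/eqP bv _] _ c] := c0.
have [//|[u [a [t [w' [e _ av _ _]]]]]] := shape_from_old c.
have : rchain (inr s) ((Out s b :: map Old u ++ [:: In a t]) ++ w').
  by rewrite cat_cons -catA cat1s -e.
rewrite rchain_cat => /andP[/chain_collapse[+ _] _].
rewrite -cat_cons collapse_cat -cat1s collapse_cat collapse_old => /avoids_out.
by rewrite /= all_cat /= av eqxx !andbF.
Qed.

End InsertionWords.

(** * Normal forms of paths and the congruence of lifts *)

Section InsertionPaths.
Variables (K : fieldType) (L : triangular K) (v : vert (tri_quiver L)).
Variables (d : Order.disp_t) (S : finPOrderType d).
Local Notation Q := (tri_quiver L).
Local Notation Qi := (ins_quiver v S).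
Local Notation V := (vert Q + S)%type.
Local Notation hw := (hasse_word L).
Local Notation Old := (@Old _ L _ S).
Local Notation "[ r ]" := (pelt K r : path_ring K Qi).
Local Notation hits := (fun a : arr Q => tgt a == v).
Local Notation avoids := (all (predC hits)).
Implicit Types (x y : V) (w m : seq (raw_arrow L S)) (u : seq (arr Q)).
Implicit Types (r : qpath Qi) (p : qpath Q) (q : qpath (hasse S)).

Lemma rend_cons x a w : rend x (a :: w) = rend (raw_tgt a) w.
Proof. by []. Qed.

Lemma spells_rchain r x w : spells r x w -> rchain v x w.
Proof. by move=> [<- <-]; exact: rchain_word. Qed.

Lemma spells_rend r x w : spells r x w -> val (pend r) = rend x w.
Proof. by move=> [<- <-]; exact: rend_word. Qed.

Lemma spells_src r x a w : spells r x (a :: w) -> x = raw_src a.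
Proof. by move=> /spells_rchain /= /and3P[_ /eqP]. Qed.

Lemma spells_collapse r x w : spells r x w -> parrows (collapse r) = collapse_word w.
Proof. by move=> [_ <-]. Qed.

Lemma collapse_vertex_old x i : collapse_vertex v x = i -> i != v -> x = inl i.
Proof. by case: x => [j|s] /= -> //; rewrite eqxx. Qed.

Lemma collapse_eqP r p : collapse_vertex v (val (pstart r)) = pstart p ->
  collapse_word (word r) = parrows p -> collapse r = p.
Proof. by move=> e1 e2; apply: qpath_inj. Qed.

Lemma collapse_comp r r1 r2 : parrows r = parrows r1 ++ parrows r2 ->
  parrows (collapse r) = parrows (collapse r1) ++ parrows (collapse r2).
Proof.
by move=> e; rewrite !parrows_collapse /word e map_cat collapse_cat.
Qed.

(** This reduces a congruence of long paths to the segments on which the defining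
    relations of the insertion speak. *)
Lemma congr_in_context (I : ideal (path_algebra K Qi)) r r' x w1 m m' w3 :
  spells r x (w1 ++ m ++ w3) -> spells r' x (w1 ++ m' ++ w3) ->
  rend (rend x w1) m = rend (rend x w1) m' ->
  (forall rm rm', spells rm (rend x w1) m -> spells rm' (rend x w1) m' ->
     I ([rm] - [rm'])) ->
  I ([r] - [r']).
Proof.
move=> /spells_split[r1 [r0 [s1 /spells_split[rm [r3 [sm s3 ->]]] ->]]].
move=> /spells_split[r1' [r0' [s1' /spells_split[rm' [r3' [sm' s3' ->]]] ->]]].
move=> e H; rewrite -e in s3'.
rewrite -(spells_inj s1 s1') -(spells_inj s3 s3') -mulrBr -mulrBl.
by apply: idealIMl; apply: idealIMr; exact: H.
Qed.

(** Cutting a path where it enters and where it leaves S gives a normal form,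
    according to the position of its ends. The parentheses isolate the segment
    that the relations [ins_rel2d] may change; the next lemmas do the same for
    [ins_rel2b] and [ins_rel2c]. *)
Lemma shape_old_old r i j : val (pstart r) = inl i -> val (pend r) = inl j ->
  (exists2 u, spells r (inl i) (map Old u) & avoids u) \/
  exists u a q b u', [/\ avoids u, tgt a = v /\ src b = v,
    is_minimal (pstart q), is_maximal (pend q) &
    spells r (inl i)
      (map Old u ++ (In a (pstart q) :: rcons (hw q) (Out (pend q) b)) ++ map Old u')].
Proof.
move=> ri rj; have sr : spells r (inl i) (word r) by rewrite -ri.
have := spells_rchain sr => /shape_from_old[[u wu av]|].
  by left; exists u => //; rewrite -wu.
move=> [u [a [s [w' [wE av ta ms c]]]]]; right.
have [q [qs [wq|[b [w'' [mx sb wq c']]]]]] := shape_from_S c.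
  have := spells_rend sr; rewrite wE wq rend_cat rend_cons.
  by rewrite /= -qs rend_hasse rj.
have c'' : rchain v (inr (pend q)) (Out (pend q) b :: w'').
  by move: c; rewrite wq rchain_cat -qs rend_hasse => /andP[].
have [u' wu' _] := shape_out c''.
exists u, a, q, b, u'; split=> //; first by rewrite qs.
by rewrite qs -wu' /= cat_rcons -wq -wE.
Qed.

Lemma shape_old_S r i s : val (pstart r) = inl i -> val (pend r) = inr s ->
  exists u a q, [/\ avoids u, tgt a = v, is_minimal (pstart q), pend q = s &
    spells r (inl i) (map Old u ++ (In a (pstart q) :: hw q) ++ [::])].
Proof.
move=> ri rj; have sr : spells r (inl i) (word r) by rewrite -ri.
have := spells_rchain sr => /shape_from_old[[u wu av]|].
  by have := spells_rend sr; rewrite wu rend_old rj.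
move=> [u [a [t [w' [wE av ta ms c]]]]].
have [q [qs [wq|[b [w'' [mx sb wq c']]]]]] := shape_from_S c.
  exists u, a, q; split=> //; rewrite ?qs // ?cats0 -?wq -?wE //.
  have := spells_rend sr; rewrite wE wq rend_cat rend_cons.
  by rewrite /= -qs rend_hasse rj => -[].
have c'' : rchain v (inr (pend q)) (Out (pend q) b :: w'').
  by move: c; rewrite wq rchain_cat -qs rend_hasse => /andP[].
have [u' wu' _] := shape_out c''.
have := spells_rend sr; rewrite wE wq wu' rend_cat rend_cons rend_cat rend_cons.
by rewrite rend_old rj.
Qed.

Lemma shape_S_old r s j : val (pstart r) = inr s -> val (pend r) = inl j ->
  exists q b u', [/\ pstart q = s, src b = v, is_maximal (pend q) &
    spells r (inr s) ([::] ++ rcons (hw q) (Out (pend q) b) ++ map Old u')].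
Proof.
move=> ri rj; have sr : spells r (inr s) (word r) by rewrite -ri.
have c := spells_rchain sr.
have [q [qs [wq|[b [w'' [mx sb wq c']]]]]] := shape_from_S c.
  by have := spells_rend sr; rewrite wq -qs rend_hasse rj.
have c'' : rchain v (inr (pend q)) (Out (pend q) b :: w'').
  by move: c; rewrite wq rchain_cat -qs rend_hasse => /andP[].
have [u' wu' _] := shape_out c''.
by exists q, b, u'; split=> //; rewrite /= cat_rcons -wu' -wq.
Qed.

Lemma shape_S_S r s t : val (pstart r) = inr s -> val (pend r) = inr t ->
  exists q, [/\ pstart q = s, pend q = t & spells r (inr s) (hw q)].
Proof.
move=> ri rj; have sr : spells r (inr s) (word r) by rewrite -ri.
have c := spells_rchain sr.
have [q [qs [wq|[b [w'' [mx sb wq c']]]]]] := shape_from_S c.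
  exists q; split=> //.
  by have := spells_rend sr; rewrite wq -qs rend_hasse rj => -[].
have c'' : rchain v (inr (pend q)) (Out (pend q) b :: w'').
  by move: c; rewrite wq rchain_cat -qs rend_hasse => /andP[].
have [u' wu' _] := shape_out c''.
have := spells_rend sr; rewrite wq wu' rend_cat rend_cons.
by rewrite rend_old rj.
Qed.

Lemma ins_rels_in (z : path_ring K Qi) : ins_rels z -> ins_ideal v S z.
Proof. exact: ideal_gen_in. Qed.

(** The collapse determines the segments of the normal form outside S, as they
    are cut off at the only passage through v, and the relations [ins_rel2a] to
    [ins_rel2d] identify all possible segments inside S. *)
Lemma collapse_congr r r' : pstart r = pstart r' -> pend r = pend r' ->
  collapse r = collapse r' -> ins_ideal v S ([r] - [r']).
Proof.
move=> es ee /(congr1 (@parrows _)) ec.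
have es' := congr1 val es; have ee' := congr1 val ee.
case rs: (val (pstart r)) => [i|s]; case re: (val (pend r)) => [j|t];
  rewrite rs in es'; rewrite re in ee'.
- have [[u su au]|[u [a [q [b [w [au [ta sb] mn mx su]]]]]]] := shape_old_old rs re;
  have [[u' su' au']|[u' [a' [q' [b' [w' [au' [ta' sb'] mn' mx' su']]]]]]] :=
    shape_old_old (esym es') (esym ee');
  rewrite (spells_collapse su) (spells_collapse su') in ec;
  rewrite ?collapse_cat ?collapse_old /= -?cats1 ?collapse_cat ?collapse_hasse /= in ec.
  + rewrite -ec in su'; rewrite (spells_inj su su') subrr; exact: idealI0.
  + by move: au; rewrite ec all_cat /= ta' eqxx andbF.
  + by move: au'; rewrite -ec all_cat /= ta eqxx andbF.
  + have [||eu ea [eb ew]] := first_unique ec au au'; rewrite ?ta ?ta' //.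
    rewrite -eu -ea -eb -ew in su'.
    apply: (congr_in_context su su').
      by rewrite -!rcons_cons /rend !map_rcons !last_rcons.
    move=> rm rm' sm sm'; have xE := spells_src sm; rewrite xE in sm sm'.
    by apply: ins_rels_in; apply: (ins_rel2d _ _ _ _ _ _ sm sm').
- have [u [a [q [au ta mn qe su]]]] := shape_old_S rs re.
  have [u' [a' [q' [au' ta' mn' qe' su']]]] := shape_old_S (esym es') (esym ee').
  rewrite (spells_collapse su) (spells_collapse su') in ec.
  rewrite ?collapse_cat ?collapse_old /= ?collapse_hasse /= in ec.
  have [||eu ea _] := first_unique ec au au'; rewrite ?ta ?ta' //.
  rewrite -eu -ea in su'; apply: (congr_in_context su su').
    by rewrite !rend_cons /= !rend_hasse qe qe'.
  move=> rm rm' sm sm'; have xE := spells_src sm; rewrite xE in sm sm'.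
  by apply: ins_rels_in; apply: (ins_rel2b _ _ _ _ sm sm') => //; rewrite qe qe'.
- have [q [b [u [qs sb mx su]]]] := shape_S_old rs re.
  have [q' [b' [u' [qs' sb' mx' su']]]] := shape_S_old (esym es') (esym ee').
  rewrite (spells_collapse su) (spells_collapse su') in ec.
  rewrite ?collapse_cat ?collapse_old -?cats1 ?collapse_cat /= ?collapse_hasse /= in ec.
  case: ec => eb eu; rewrite -eb -eu in su'; apply: (congr_in_context su su').
    by rewrite /rend !map_rcons !last_rcons.
  rewrite /rend /= => rm rm'; rewrite -{1}qs -qs' => sm sm'.
  by apply: ins_rels_in; apply: (ins_rel2c _ _ _ _ sm sm') => //; rewrite qs qs'.
- have [q [qs qe su]] := shape_S_S rs re.
  have [q' [qs' qe' su']] := shape_S_S (esym es') (esym ee').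
  rewrite -qs in su; rewrite -qs' in su'.
  by apply: ins_rels_in; apply: (ins_rel2a _ _ su su'); rewrite ?qs ?qs' ?qe ?qe'.
Qed.

End InsertionPaths.

(** * Existence of lifts *)

Section Lifts.
Variables (K : fieldType) (L : triangular K) (v : vert (tri_quiver L)).
Variables (d : Order.disp_t) (S : finPOrderType d).
Local Notation Q := (tri_quiver L).
Local Notation Qi := (ins_quiver v S).
Local Notation V := (vert Q + S)%type.
Local Notation hw := (hasse_word L).
Local Notation Old := (@Old _ L _ S).
Local Notation "[ r ]" := (pelt K r : path_ring K Qi).
Local Notation hits := (fun a : arr Q => tgt a == v).
Local Notation avoids := (all (predC hits)).
Implicit Types (x y : V) (w m : seq (raw_arrow L S)) (u : seq (arr Q)).
Implicit Types (r : qpath Qi) (p : qpath Q) (q : qpath (hasse S)).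

Lemma path_into_collapse s p r : path_into s p r ->
  collapse r = p /\ val (pend r) = inr s.
Proof.
move=> [u [a [pu sr]]]; split; last first.
  by rewrite (spells_rend sr) /rend map_rcons last_rcons.
apply: collapse_eqP; first by case: sr => -> _.
rewrite -parrows_collapse (spells_collapse sr) -cats1 collapse_cat collapse_old.
by rewrite pu cats1.
Qed.

Lemma path_out_collapse s p r : pstart p = v -> path_out_of s p r ->
  [/\ collapse r = p, val (pstart r) = inr s & val (pend r) = inl (pend p)].
Proof.
move=> pv [b [u [pu sr]]]; split; [|by case: sr|]; last first.
  by rewrite (spells_rend sr) rend_cons rend_old /pend pu.
apply: collapse_eqP; first by case: sr => -> _; rewrite pv.
by rewrite -parrows_collapse (spells_collapse sr) /= collapse_old pu.
Qed.

Lemma path_lift_collapse p r : path_lift p r ->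
  collapse r = p /\ val (pstart r) = inl (pstart p).
Proof.
move=> [[_ sr]|[u [a [b [u' [q [pu _ _ _ sr]]]]]]]; split; try by case: sr.
  apply: collapse_eqP; first by case: sr => -> _.
  by rewrite -parrows_collapse (spells_collapse sr) collapse_old.
apply: collapse_eqP; first by case: sr => -> _.
rewrite -parrows_collapse (spells_collapse sr) pu collapse_cat collapse_old /=.
by rewrite collapse_cat collapse_hasse /= collapse_old.
Qed.

Lemma path_into_exists p s : pstart p != v -> pend p = v -> is_minimal s ->
  exists r, path_into s p r.
Proof.
move=> pv ev ms; have := qpath_chainE p; move: ev; rewrite /pend.
case/lastP pu: (parrows p) => [|u a]; first by move=> /= e; rewrite e eqxx in pv.
rewrite map_rcons last_rcons => av c.
have au := avoids_in c av.
have c2 : rchain v (inl (pstart p)) (rcons (map Old u) (In a s)).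
  move: c; rewrite -!cats1 chain_cat rchain_cat => /andP[cu].
  by rewrite rend_old rchain_old //= av eqxx ms !andbT => /eqP ->; rewrite /= eqxx.
have [r sr] := spells_exists (x := inl (pstart p)) pv c2.
by exists r, u, a.
Qed.

Lemma rchain_out b u s : chain v (b :: u) -> is_maximal s ->
  rchain v (inr s) (Out s b :: map Old u).
Proof.
move=> c ms; have /= /andP[bv au] := avoids_out c.
move: c => /= /andP[sb cu]; rewrite sb ms eqxx /=.
exact: rchain_old.
Qed.

Lemma path_out_exists p s : pstart p = v -> pend p != v -> is_maximal s ->
  exists r, path_out_of s p r.
Proof.
move=> pv ev ms; have := qpath_chainE p; move: ev; rewrite /pend pv.
case pu: (parrows p) => [|b u]; first by rewrite /= eqxx.
move=> _ c; have [r sr] := spells_exists (x := inr s) isT (rchain_out c ms).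
by exists r, b, u.
Qed.

Lemma path_lift_exists p : S -> pstart p != v -> pend p != v ->
  exists r, path_lift p r.
Proof.
move=> s0 pv ev; have c := qpath_chainE p.
have [au|[u [a [u2 [pu au /eqP av]]]]] := split_at_first hits (parrows p).
  have [r sr] := spells_exists (x := inl (pstart p)) pv
    (@rchain_old _ _ _ _ S _ _ pv c au).
  by exists r; left; split=> // a /(allP au).
case: u2 pu => [|b u'] pu.
  by move: ev; rewrite /pend pu map_cat last_cat /= av eqxx.
have [s ms _] := minimal_below s0; have [t mt st] := maximal_above s.
have [q [qs qt]] := hasse_path st.
move: c; rewrite pu chain_cat -cat1s => /andP[cu]; rewrite /= => /andP[sa].
rewrite av => cb.
have cr : rchain v (inl (pstart p))
    (map Old u ++ In a (pstart q) :: hw q ++ Out (pend q) b :: map Old u').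
  rewrite rchain_cat rend_old rchain_old //= av eqxx qs ms (eqP sa) eqxx -qs.
  rewrite rchain_cat rchain_hasse rend_hasse; apply: rchain_out => //.
  by rewrite qt.
have [r sr] := spells_exists (x := inl (pstart p)) pv cr.
by exists r; right; exists u, a, b, u', q; split=> //; rewrite ?qs ?qt.
Qed.

Lemma hasse_lift q : exists r, [/\ val (pstart r) = inr (pstart q),
  val (pend r) = inr (pend q) & parrows (collapse r) = [::]].
Proof.
have [r sr] := spells_exists (x := inr (pstart q)) isT (rchain_hasse v q).
exists r; rewrite (spells_rend sr) rend_hasse (spells_collapse sr) collapse_hasse.
by case: sr => ->.
Qed.

Lemma qcomp r1 r2 : pend r1 = pstart r2 ->
  exists r, [/\ [r1] * [r2] = [r], pstart r = pstart r1, pend r = pend r2 &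
    parrows (collapse r) = parrows (collapse r1) ++ parrows (collapse r2)].
Proof.
move=> /(peltM K)[r [re rs rt ra]]; exists r; split=> //; exact: collapse_comp.
Qed.

Lemma pend_old r p j : collapse r = p -> pend p = j -> j != v ->
  val (pend r) = inl j.
Proof.
by move=> rp pj jv; apply: (collapse_vertex_old _ jv); rewrite -pend_collapse rp.
Qed.

Lemma pstart_old r p j : collapse r = p -> pstart p = j -> j != v ->
  val (pstart r) = inl j.
Proof.
by move=> rp pj jv; apply: (collapse_vertex_old _ jv); rewrite -pstart_collapse rp.
Qed.

Definition liftable x y : bool :=
  match x, y with inr s, inr t => (s <= t)%O | _, _ => true end.

(** A path that ends or starts at an element of S is lifted to a minimal element
    below it or a maximal element above it, where the arrows In and Out are
    attached, and is continued inside S. A path from S to S collapses to a path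
    from v to v, which is trivial, so there the order relation is what is
    needed. *)
Lemma lift_exists (x y : vert Qi) p : S -> liftable (val x) (val y) ->
  pstart p = collapse_vertex v (val x) -> pend p = collapse_vertex v (val y) ->
  exists r, [/\ pstart r = x, pend r = y & collapse r = p].
Proof.
move=> s0; case: x => -[i|s] xv; case: y => -[j|t] yv /= st ps pe.
- have pv : pstart p != v by rewrite ps.
  have ev : pend p != v by rewrite pe.
  have [r lr] := path_lift_exists s0 pv ev.
  have [rp rs] := path_lift_collapse lr; exists r; split=> //; apply: val_inj => /=.
    by rewrite rs ps.
  exact: pend_old rp pe yv.
- have pv : pstart p != v by rewrite ps.
  have [m mm ms] := minimal_below t.
  have [r1 l1] := path_into_exists pv pe mm; have [c1 e1] := path_into_collapse l1.
  have [q [qs qe]] := hasse_path ms; have [r2 [s2 e2 c2]] := hasse_lift q.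
  have e12 : pend r1 = pstart r2 by apply: val_inj; rewrite e1 s2 qs.
  have [r [_ rs re ra]] := qcomp e12; exists r; split.
  + rewrite rs; apply: val_inj => /=.
    exact: pstart_old c1 ps xv.
  + by rewrite re; apply: val_inj; rewrite e2 qe.
  + apply: qpath_inj; last by rewrite ra c1 c2 cats0.
    by rewrite pstart_collapse rs -pstart_collapse c1.
- have ev : pend p != v by rewrite pe.
  have [m mm sm] := maximal_above s.
  have [r2 l2] := path_out_exists ps ev mm; have [c2 s2 _] := path_out_collapse ps l2.
  have [q [qs qe]] := hasse_path sm; have [r1 [s1 e1 c1]] := hasse_lift q.
  have e12 : pend r1 = pstart r2 by apply: val_inj; rewrite e1 s2 qe.
  have [r [_ rs re ra]] := qcomp e12; exists r; split.
  + by rewrite rs; apply: val_inj; rewrite s1 qs.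
  + rewrite re; apply: val_inj => /=.
    exact: pend_old c2 pe yv.
  + apply: qpath_inj; last by rewrite ra c1 c2.
    by rewrite pstart_collapse rs s1 ps.
- have [q [qs qe]] := hasse_path st; have [r [rs re rc]] := hasse_lift q.
  exists r; split; try by apply: val_inj; rewrite ?rs ?re ?qs ?qe.
  apply: qpath_inj; first by rewrite pstart_collapse rs ps.
  rewrite rc; apply/esym/(chain_loop (i := v)).
    by rewrite -ps; exact: qpath_chainE.
  by rewrite -{1}ps -/(pend p) pe.
Qed.

End Lifts.

(** * Collapsing preserves relations *)

Lemma eq_lext_in (K : fieldType) (P : choiceType) (V : lmodType K) (F F' : P -> V)
    (f : {malg K[P]}) :
  (forall k, k \in msupp f -> F k = F' k) -> lext F f = lext F' f.
Proof.
move=> FF'; rewrite /lext [LHS]big_seq [RHS]big_seq.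
by apply: eq_bigr => k kf; rewrite FF'.
Qed.

Section FunctorIdeal.
Local Open Scope classical_set_scope.
Variables (K : fieldType) (Q Q' : quiver) (I' : ideal (path_algebra K Q')).
Variables (f0 : vert Q -> vert Q') (c : qpath Q -> qpath Q').
Hypothesis cs : forall p, pstart (c p) = f0 (pstart p).
Hypothesis ce : forall p, pend (c p) = f0 (pend p).
Hypothesis cM : forall p q r, pstart r = pstart p -> pend p = pstart q ->
  parrows r = parrows p ++ parrows q ->
  parrows (c r) = parrows (c p) ++ parrows (c q).
Local Notation "[ r ]" := (pelt K r : path_ring K _).

Lemma functor_comp p q : pend p = pstart q -> exists r,
  [/\ [p] * [q] = [r], pstart r = pstart p, pend r = pend q & [c p] * [c q] = [c r]].
Proof.
move=> pq; have [r [rE rs re ra]] := peltM K pq; exists r; split=> //.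
have cpq : pend (c p) = pstart (c q) by rewrite ce cs pq.
have [r' [-> rs' re' ra']] := peltM K cpq; congr pelt; apply: qpath_inj.
  by rewrite rs' !cs rs.
by rewrite ra' (cM rs pq ra).
Qed.

Lemma corner_ext_mull p (z : path_ring K Q) i j : corner_ext i j c ([p] * z) =
  if pstart p == i then [c p] * corner_ext (pend p) j c z else 0.
Proof.
rewrite -{1}(lext_pelt z) mul_lextr corner_ext_lext.
have -> : (if pstart p == i then [c p] * corner_ext (pend p) j c z else 0) =
  lext (fun q => if pstart p == i then [c p] * (corner_ext (pend p) j c [q]) else 0) z.
  case: (_ == _); last exact/esym/lext0F.
  apply: (etrans (mul_lextr [c p] (fun q =>
    if (pstart q == pend p) && (pend q == j) then [c q] else 0) z)).
  by apply: eq_lext => q; rewrite corner_ext_pelt.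
apply: eq_lext => q; rewrite corner_ext_pelt.
have [pq|pq] := eqVneq (pend p) (pstart q).
  have [r [prod rs re crE]] := functor_comp pq; rewrite /= prod.
  rewrite corner_ext_pelt rs re; case: (pstart p == i) => //=.
  by case: (pend q == j); rewrite ?mulr0 // crE.
by rewrite /= peltM0 // corner_ext0 /= mulr0 if_same.
Qed.

Lemma corner_ext_mulr p (z : path_ring K Q) i j : corner_ext i j c (z * [p]) =
  if pend p == j then corner_ext i (pstart p) c z * [c p] else 0.
Proof.
rewrite -{1}(lext_pelt z) mul_lextl corner_ext_lext.
have -> : (if pend p == j then corner_ext i (pstart p) c z * [c p] else 0) =
  lext (fun q => if pend p == j then corner_ext i (pstart p) c [q] * [c p] else 0) z.
  case: (_ == _); last exact/esym/lext0F.
  apply: (etrans (mul_lextl [c p] (fun q =>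
    if (pstart q == i) && (pend q == pstart p) then [c q] else 0) z)).
  by apply: eq_lext => q; rewrite corner_ext_pelt.
apply: eq_lext => q; rewrite corner_ext_pelt.
have [pq|pq] := eqVneq (pend q) (pstart p).
  have [r [prod rs re crE]] := functor_comp pq; rewrite /= prod.
  rewrite corner_ext_pelt rs re andbT andbC; case: (pend p == j) => //=.
  by case: (pstart q == i); rewrite ?mul0r // crE.
by rewrite /= peltM0 // corner_ext0 andbF mul0r if_same.
Qed.

(** For a functor c, the maps [corner_ext i j c] are the entries of a
    multiplicative linear map to matrices over the path algebra of Q'. The
    elements with all entries in I' are the preimage of an ideal of matrices. *)
Lemma functor_ideal : two_sided_ideal
  ([set z | forall i j, I' (corner_ext i j c z)] : set (path_algebra K Q)).
Proof.
split=> [i j|x y Jx Jy i j|a x Jx i j|a x Jx i j].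
- rewrite corner_ext0; exact: idealI0.
- rewrite corner_extD; exact: (idealID (Jx i j) (Jy i j)).
- suff : I' (corner_ext i j c ((a : path_ring K Q) * x)) by [].
  rewrite -(lext_pelt (a : path_ring K Q)) mul_lextl corner_ext_lext.
  apply: ideal_lext => p _ /=; rewrite corner_ext_mull.
  by case: ifP => _; [apply: idealIMl; exact: Jx|exact: idealI0].
- suff : I' (corner_ext i j c ((x : path_ring K Q) * a)) by [].
  rewrite -(lext_pelt (a : path_ring K Q)) mul_lextr corner_ext_lext.
  apply: ideal_lext => p _ /=; rewrite corner_ext_mulr.
  by case: ifP => _; [apply: idealIMr; exact: Jx|exact: idealI0].
Qed.

End FunctorIdeal.

Section InsertionPeirce.
Variables (K : fieldType) (L : triangular K) (v : vert (tri_quiver L)).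
Variables (d : Order.disp_t) (S : finPOrderType d).
Local Notation Q := (tri_quiver L).
Local Notation Qi := (ins_quiver v S).
Local Notation "[ r ]" := (pelt K r : path_ring K _).
Implicit Types (x y : vert Qi) (p : qpath Q) (r : qpath Qi).

Lemma collapse_functor r1 r2 r : pstart r = pstart r1 -> pend r1 = pstart r2 ->
  parrows r = parrows r1 ++ parrows r2 ->
  parrows (collapse r) = parrows (collapse r1) ++ parrows (collapse r2).
Proof. by move=> _ _; exact: collapse_comp. Qed.

Lemma corner_ext_pair r r' x y : pstart r = pstart r' -> pend r = pend r' ->
  collapse r = collapse r' ->
  tri_ideal L (corner_ext x y (@collapse _ L v _ S) ([r] - [r'])).
Proof.
move=> es ee ec; rewrite corner_extB; apply: idealI_eq.
refine (etrans (corner_ext_pelt K x y _ r) _).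
refine (etrans _ (esym (corner_ext_pelt K x y _ r'))).
by rewrite es ee ec.
Qed.

Lemma corner_ext_lift (l : qpath Q -> qpath Qi) (z : path_ring K Q) x y
    (x' y' : vert Q + S) :
  tri_ideal L z ->
  (forall p, p \in msupp z -> [/\ val (pstart (l p)) = x', val (pend (l p)) = y' &
    collapse (l p) = p]) ->
  tri_ideal L (corner_ext x y (@collapse _ L v _ S) (lext (fun p => [l p]) z)).
Proof.
move=> Iz lz; rewrite corner_ext_lext.
pose F b p : path_ring K Q := if b then pelt K p else 0.
have IF b : tri_ideal L (lext (F b) z).
  case: b; first by have -> : lext (F true) z = z by exact: lext_pelt.
  have -> : lext (F false) z = 0 by exact: lext0F.
  exact: idealI0.
have eqv (a b : vert Qi) : (a == b) = (val a == val b) by [].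
suff <- : lext (F ((x' == val x) && (y' == val y))) z =
    lext (fun p => corner_ext x y (@collapse _ L v _ S) [l p]) z by [].
apply: eq_lext_in => p /lz[ps pe pc].
refine (etrans _ (esym (corner_ext_pelt K x y _ (l p)))).
by rewrite (eqv _ x) (eqv _ y) ps pe pc.
Qed.

(** On generators: the two paths of [ins_rel2a] to [ins_rel2d] have the same
    collapse, and the other generators collapse to the combination in I that they
    lift. *)
Lemma collapse_ideal (z : path_ring K Qi) x y : ins_ideal v S z ->
  tri_ideal L (corner_ext x y (@collapse _ L v _ S) z).
Proof.
move=> Iz; pose f0 (x : vert Qi) : vert Q := collapse_vertex v (val x).
have J := @functor_ideal K Qi Q (tri_ideal L) f0 (@collapse _ L v _ S)
  (@pstart_collapse _ L v _ S) (@pend_collapse _ L v _ S) collapse_functor.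
apply: (@ideal_gen_sub K (path_algebra K Qi) _ _ J _ z Iz) => {x y z Iz J}.
have same r r' (x : vert Q + S) w w' : spells r x w -> spells r' x w' ->
    rend x w = rend x w' -> collapse_word w = collapse_word w' ->
  [/\ pstart r = pstart r', pend r = pend r' & collapse r = collapse r'].
  move=> sr sr' e c; have es : pstart r = pstart r'.
    by apply: val_inj; case: sr => -> _; case: sr' => -> _.
  split=> //; first by apply: val_inj; rewrite (spells_rend sr) (spells_rend sr').
  apply: qpath_inj; first by rewrite !pstart_collapse es.
  by rewrite (spells_collapse sr) (spells_collapse sr').
have pair r r' (x : vert Q + S) w w' : spells r x w -> spells r' x w' ->
    rend x w = rend x w' -> collapse_word w = collapse_word w' ->
  forall i j, tri_ideal L (corner_ext i j (@collapse _ L v _ S) ([r] - [r'])).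
  move=> sr sr' e c i j; have [es ee ec] := same _ _ _ _ _ sr sr' e c.
  exact: corner_ext_pair.
move=> _ [s z l ms Iz [i [j zP]] lP|s z l ms Iz [i [j zP]] lP|
  q q' r r' es ee sr sr'|a q q' r r' ta mn mn' ee sr sr'|
  b q q' r r' ta mn mn' ee sr sr'|a b q q' r r' ta tb mn mn' mx mx' sr sr'|
  z l Iz [i [j zP]] lP] x y.
- apply: (@corner_ext_lift _ _ _ _ (inl i) (inr s) Iz) => p pz.
  have [ps _ _] := zP p pz; have [pc pe] := path_into_collapse (lP p pz).
  by split=> //; case: (lP p pz) => [u [a [_ [-> _]]]]; rewrite ps.
- apply: (@corner_ext_lift _ _ _ _ (inr s) (inl j) Iz) => p pz.
  have [_ pe ps] := zP p pz; have [pc ps' pe'] := path_out_collapse ps (lP p pz).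
  by split=> //; rewrite pe' pe.
- rewrite -es in sr'; refine (pair _ _ _ _ _ sr sr' _ _ x y);
    last by rewrite !collapse_hasse.
  by rewrite {2}es !rend_hasse ee.
- refine (pair _ _ _ _ _ sr sr' _ _ x y); last by rewrite /= !collapse_hasse.
  by rewrite !rend_cons /= !rend_hasse ee.
- rewrite -ee in sr'; refine (pair _ _ _ _ _ sr sr' _ _ x y).
    by rewrite /rend !map_rcons !last_rcons.
  by rewrite -!cats1 !collapse_cat !collapse_hasse.
- refine (pair _ _ _ _ _ sr sr' _ _ x y).
    by rewrite -!rcons_cons /rend !map_rcons !last_rcons.
  by rewrite /= -!cats1 !collapse_cat !collapse_hasse.
- apply: (@corner_ext_lift _ _ _ _ (inl i) (inl j) Iz) => p pz.
  have [ps pe [psv pev]] := zP p pz; have [pc pst] := path_lift_collapse (lP p pz).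
  by split; rewrite ?pst ?ps //; apply: (pend_old pc pe); rewrite -pe.
Qed.

End InsertionPeirce.

(** * Lifting preserves relations *)

Lemma msupp_peirce (K : fieldType) (Q : quiver) (z : path_ring K Q) i j p :
  p \in msupp ((pelt K (ptriv i) : path_ring K Q) * z * pelt K (ptriv j)) ->
  pstart p = i /\ pend p = j.
Proof.
move=> pz; suff /andP[/eqP -> /eqP ->] : (pstart p == i) && (pend p == j) by [].
apply: contraLR pz => np; rewrite peirce_pathE -mcoeff_eq0; apply/eqP.
rewrite /lext raddf_sum big1 // => q _; rewrite /= path_coeffZ.
have [qi|_] := boolP ((pstart q == i) && (pend q == j)); last by rewrite mcoeff0 mulr0.
rewrite mcoeffU; have [qp|] := eqVneq q p; last by rewrite mulr0.
by rewrite -qp qi in np.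
Qed.

Section LiftIdeal.
Variables (K : fieldType) (L : triangular K) (v : vert (tri_quiver L)).
Variables (d : Order.disp_t) (S : finPOrderType d).
Local Notation Q := (tri_quiver L).
Local Notation Qi := (ins_quiver v S).
Local Notation "[ r ]" := (pelt K r : path_ring K _).
Local Notation Ii := (ins_ideal v S).
Local Notation bd x := (collapse_vertex v (val x)).
Implicit Types (x y : vert Qi) (p : qpath Q) (r : qpath Qi).

Lemma lift_choice (P : qpath Q -> qpath Qi -> Prop) (z : path_ring K Q) x :
  (forall p, p \in msupp z -> exists r, P p r) ->
  exists l : qpath Q -> qpath Qi, forall p, p \in msupp z -> P p (l p).
Proof.
move=> H; have /choice[l lP] p : exists r, p \in msupp z -> P p r.
  have [/H[r Pr]|_] := boolP (p \in msupp z); first by exists r.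
  by exists (ptriv x).
by exists l.
Qed.

Lemma lext_congr (F G : qpath Q -> path_ring K Qi) (z : path_ring K Q) :
  (forall p, p \in msupp z -> Ii (F p - G p)) -> Ii (lext G z) -> Ii (lext F z).
Proof.
move=> FG; apply: ideal_congD; rewrite lextB_F.
by apply: ideal_lext.
Qed.

(** Modulo the ideal the choice of lifts is free, by [collapse_congr]. If both ends
    are outside S, then [ins_rel3] applies. If the end t is in S, paths can be
    lifted through a minimal m below t, so that [ins_rel1a] applies to the part
    up to m; dually [ins_rel1b] when the start is in S. If both ends are in S,
    only the trivial path at v is left, and its coefficient is 0. *)
Lemma lift_ideal (l : qpath Q -> qpath Qi) (z : path_ring K Q) x y : S ->
  (forall p, pstart p = bd x -> pend p = bd y ->
     [/\ pstart (l p) = x, pend (l p) = y & collapse (l p) = p]) ->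
  tri_ideal L z -> Ii (corner_ext (bd x) (bd y) l z).
Proof.
move=> s0 lP Iz; rewrite corner_extE; set z' := _ * z * _.
have Iz' : tri_ideal L z' by apply: idealIMr; apply: idealIMl.
have sz p : p \in msupp z' -> pstart p = bd x /\ pend p = bd y by exact: msupp_peirce.
have -> : corner_ext (bd x) (bd y) l z' = lext (fun p => [l p]) z'.
  by apply: eq_lext_in => p /sz[-> ->]; rewrite !eqxx.
have {}lP p : p \in msupp z' ->
    [/\ pstart (l p) = x, pend (l p) = y & collapse (l p) = p].
  by move=> /sz[ps pe]; exact: lP.
clearbody z'; clear z Iz.
case: x lP sz => -[i|s] xv; case: y => -[j|t] yv lP sz.
- have [l0 l0P] : exists l0 : qpath Q -> qpath Qi,
      forall p, p \in msupp z' -> path_lift p (l0 p).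
    apply: (lift_choice (exist _ (inl i) xv)) => p /sz[ps pe].
    by apply: path_lift_exists => //; rewrite ?ps ?pe.
  apply: (@lext_congr _ (fun p => [l0 p])) => [p pz|].
    have [ps pe] := sz p pz; have [ls le lc] := lP p pz.
    have [c0 s0'] := path_lift_collapse (l0P p pz).
    apply: collapse_congr; rewrite ?lc ?c0 // ?ls ?le; apply: val_inj;
      rewrite ?s0' ?ps //.
    by rewrite (pend_old c0 pe).
  apply: ins_rels_in; apply: ins_rel3 => //.
  by exists i, j => p /sz[ps pe]; rewrite ps pe; split.
- have [m mm mt] := minimal_below t; have [q [qs qt]] := hasse_path mt.
  have [rq [rs re rc]] := hasse_lift v q.
  have [l0 l0P] : exists l0 : qpath Q -> qpath Qi,
      forall p, p \in msupp z' -> path_into m p (l0 p).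
    apply: (lift_choice (exist _ (inl i) xv)) => p /sz[ps pe].
    by apply: path_into_exists => //; rewrite ?ps.
  have I0 : Ii (lext (fun p => [l0 p]) z').
    apply: ins_rels_in; apply: (ins_rel1a mm Iz') => //.
    by exists i, v => p /sz[ps pe].
  apply: (@lext_congr _ (fun p => [l0 p] * [rq])) => [p pz|]; last first.
    by rewrite -mul_lextl; exact: idealIMr.
  have [ps pe] := sz p pz; have [ls le lc] := lP p pz.
  have [c0 e0] := path_into_collapse (l0P p pz).
  have e : pend (l0 p) = pstart rq by apply: val_inj; rewrite e0 rs qs.
  have [r [-> rs' re' rc']] := qcomp e.
  have st : pstart (l p) = pstart r.
    by apply: val_inj; rewrite ls rs' (pstart_old c0 ps).
  apply: collapse_congr => //; first by apply: val_inj; rewrite le re' re qt.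
  apply: qpath_inj; first by rewrite !pstart_collapse st.
  by rewrite rc' lc c0 rc cats0.
- have [m mm mt] := maximal_above s; have [q [qs qt]] := hasse_path mt.
  have [rq [rs re rc]] := hasse_lift v q.
  have [l0 l0P] : exists l0 : qpath Q -> qpath Qi,
      forall p, p \in msupp z' -> path_out_of m p (l0 p).
    apply: (lift_choice (exist _ (inl j) yv)) => p /sz[ps pe].
    by apply: path_out_exists => //; rewrite ?pe.
  have I0 : Ii (lext (fun p => [l0 p]) z').
    apply: ins_rels_in; apply: (ins_rel1b mm Iz') => //.
    by exists v, j => p /sz[ps pe].
  apply: (@lext_congr _ (fun p => [rq] * [l0 p])) => [p pz|]; last first.
    by rewrite -mul_lextr; exact: idealIMl.
  have [ps pe] := sz p pz; have [ls le lc] := lP p pz.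
  have [c0 s0' e0] := path_out_collapse ps (l0P p pz).
  have e : pend rq = pstart (l0 p) by apply: val_inj; rewrite s0' re qt.
  have [r [-> rs' re' rc']] := qcomp e.
  have st : pstart (l p) = pstart r by apply: val_inj; rewrite ls rs' rs qs.
  apply: collapse_congr => //; first by apply: val_inj; rewrite le re' e0 pe.
  apply: qpath_inj; first by rewrite !pstart_collapse st.
  by rewrite rc' lc c0 rc.
- apply: ideal_lext => p pz; have [/= ps pe] := sz p pz.
  have pE : p = ptriv v.
    apply: qpath_inj => //; apply: (chain_loop (i := v)).
      by rewrite -ps; exact: qpath_chainE.
    by rewrite -{1}ps -/(pend p) pe.
  by move: pz; rewrite pE -mcoeff_neq0 (tri_ideal_triv _ Iz') eqxx.
Qed.

End LiftIdeal.

(** * The Cartan matrix of an insertion and the theorem *)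

Section HomDimensions.
Variables (K : fieldType) (L : triangular K) (v : vert (tri_quiver L)).
Variables (d : Order.disp_t) (S : finPOrderType d).
Local Notation Q := (tri_quiver L).
Local Notation Qi := (ins_quiver v S).
Local Notation Ii := (ins_ideal v S).
Local Notation bd x := (collapse_vertex v (val x)).

Lemma vertex_idemK (Q0 : quiver) (I : ideal (path_algebra K Q0)) i :
  vertex_idem I i * vertex_idem I i = vertex_idem I i.
Proof. by rewrite vertex_idem_orth eqxx. Qed.

Lemma hom_dim_insertion (x y : vert Qi) : S ->
  hom_dim (vertex_idem Ii y) (vertex_idem Ii x) =
  if liftable (val x) (val y)
  then hom_dim (vertex_idem (tri_ideal L) (bd y)) (vertex_idem (tri_ideal L) (bd x))
  else 0%N.
Proof.
move=> s0; rewrite !hom_dim_peirce ?vertex_idemK //.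
have [xy|] := boolP (liftable (val x) (val y)); last first.
  case xE: (val x) => [i|s] //; case yE: (val y) => [j|t] //= /negP st.
  apply: dimension_no_path => r rx ry; apply: st.
  have rs : val (pstart r) = inr s by rewrite rx.
  have rt : val (pend r) = inr t by rewrite ry.
  have [q [<- <- _]] := shape_S_S rs rt; exact: hasse_path_le.
have /choice[l lP] p : exists r : qpath Qi, pstart p = bd x -> pend p = bd y ->
    [/\ pstart r = x, pend r = y & collapse r = p].
  have [ps|] := pselect (pstart p = bd x); last by exists (ptriv x).
  have [pe|] := pselect (pend p = bd y); last by exists (ptriv x).
  by have [r rP] := lift_exists s0 xy ps pe; exists r.
have ends (r : qpath Qi) : pstart r = x -> pend r = y ->
    pstart (collapse r) = bd x /\ pend (collapse r) = bd y.
  by move=> rx ry; rewrite pstart_collapse pend_collapse rx ry.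
apply: (@peirce_iso K Qi Q Ii (tri_ideal L) x y (bd x) (bd y)
  (@collapse _ L v _ S) l ends).
- by move=> p ps pe; have [-> ->] := lP p ps pe.
- move=> r rx ry; have [cx cy] := ends r rx ry; have [lx ly lc] := lP _ cx cy.
  by apply: collapse_congr; rewrite ?lx ?ly ?lc.
- by move=> p ps pe; have [_ _ lc] := lP p ps pe; apply: idealI_eq; rewrite lc.
- by move=> z; exact: collapse_ideal.
- move=> z; exact: lift_ideal.
Qed.

Lemma hom_dim_vertex :
  hom_dim (vertex_idem (tri_ideal L) v) (vertex_idem (tri_ideal L) v) = 1%N.
Proof.
rewrite hom_dim_peirce ?vertex_idemK //; apply: dimension_vertex.
  exact: tri_acyclic.
by move=> z; exact: tri_ideal_triv.
Qed.

End HomDimensions.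

Section Coxeter.
Variable K : fieldType.

Definition cox_entry (a b : nat) : {poly int} := 'X * (a%:Z)%:P + (b%:Z)%:P.

Definition hdim (A : idem_algebra K) (i j : ia_vert A) : nat :=
  hom_dim (ia_idem i) (ia_idem j).

Lemma coxeter_poly_reindex (A : idem_algebra K) m (h : 'I_m -> ia_vert A) :
  bijective h -> coxeter_poly A =
  \det (\matrix_(i, j) cox_entry (hdim (h i) (h j)) (hdim (h j) (h i))).
Proof.
move=> hb; rewrite -(det_reindex (fun i j => cox_entry (hdim i j) (hdim j i)) hb).
by congr (\det _); apply/matrixP => i j; rewrite !mxE.
Qed.

Variables (L : triangular K) (v : vert (tri_quiver L)).
Variables (d : Order.disp_t) (S : finPOrderType d).
Local Notation Q := (tri_quiver L).
Local Notation T := ({i : vert Q | i != v} : finType).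
Local Notation n := #|T|.

Definition old (i : 'I_n) : vert Q := val (enum_val i : T).

Lemma old_neq i : old i != v.
Proof. exact: (valP (enum_val i : T)). Qed.

Definition tri_enum (i : 'I_(n + 1)) : vert Q :=
  if fintype.split i is inl a then old a else v.

Definition ins_enum (i : 'I_(n + #|S|)) : ins_vert v S :=
  match fintype.split i with
  | inl a => exist _ (inl (old a)) (old_neq a)
  | inr b => exist _ (inr (enum_val b)) isT
  end.

Lemma inj_surj_bij (A B : Type) (f : A -> B) :
  injective f -> (forall y, exists x, f x = y) -> bijective f.
Proof.
move=> f_inj /choice[g gK]; exists g => // x; apply: f_inj; exact: gK.
Qed.

Lemma old_inj : injective old.
Proof. by move=> i j /val_inj /enum_val_inj. Qed.

Lemma old_surj x : x != v -> exists i, old i = x.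
Proof.
by move=> xv; exists (enum_rank (exist _ x xv : T)); rewrite /old enum_rankK.
Qed.

Lemma tri_enum_bij : bijective tri_enum.
Proof.
apply: inj_surj_bij => [i j|x].
  rewrite /tri_enum; case: split_ordP => a ->; case: split_ordP => b -> e.
  - by rewrite (old_inj e).
  - by have := old_neq a; rewrite e eqxx.
  - by have := old_neq b; rewrite -e eqxx.
  - by rewrite [a]ord1 [b]ord1.
have [->|/old_surj[i <-]] := eqVneq x v.
  by exists (rshift n ord0); rewrite /tri_enum (unsplitK (inr _)).
by exists (lshift 1 i); rewrite /tri_enum (unsplitK (inl _)).
Qed.

Lemma ins_enum_bij : bijective ins_enum.
Proof.
apply: inj_surj_bij => [i j|x].
  rewrite /ins_enum.
  case: split_ordP => a ->; case: split_ordP => b -> /(congr1 val) //=.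
  - by move=> [/old_inj ->].
  - by move=> [/enum_val_inj ->].
case: x => -[i iv|s sv].
  have [a ai] := old_surj (iv : i != v); exists (lshift _ a).
  by rewrite /ins_enum (unsplitK (inl _)); apply: val_inj; rewrite /= ai.
exists (rshift _ (enum_rank s)).
by rewrite /ins_enum (unsplitK (inr _)); apply: val_inj; rewrite /= enum_rankK.
Qed.

(** The matrix x C + C^T for the incidence algebra of S. *)
Definition poset_mx : 'M[{poly int}]_#|S| := \matrix_(i, j)
  cox_entry (enum_val j <= enum_val i :> S)%O (enum_val i <= enum_val j :> S)%O.

Local Notation hd := (@hdim (tri_algebra L)).

Definition old_mx : 'M[{poly int}]_n :=
  \matrix_(i, j) cox_entry (hd (old i) (old j)) (hd (old j) (old i)).
Definition in_mx : 'cV[{poly int}]_n := \col_i cox_entry (hd (old i) v) (hd v (old i)).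
Definition out_mx : 'rV[{poly int}]_n := \row_j cox_entry (hd v (old j)) (hd (old j) v).

Lemma coxeter_corner : coxeter_poly (tri_corner v) = \det old_mx.
Proof.
rewrite (@coxeter_poly_reindex (tri_corner v) _ (enum_val : 'I_n -> T)); last first.
  by exists enum_rank; [exact: enum_valK|exact: enum_rankK].
congr (\det _); apply/matrixP => i j; rewrite !mxE /hdim.
by rewrite !(@hom_dim_corner K (tri_algebra L) v).
Qed.

Lemma cox_entry1 : cox_entry 1 1 = 'X + 1.
Proof. by rewrite /cox_entry mulr1. Qed.

Lemma coxeter_tri : coxeter_poly (tri_algebra L) =
  \det (block_mx old_mx in_mx out_mx ('X + 1)%:M).
Proof.
rewrite (@coxeter_poly_reindex (tri_algebra L) _ _ tri_enum_bij); congr (\det _).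
apply/matrixP => i j; rewrite !mxE /tri_enum.
case: split_ordP => a _; rewrite !mxE; case: split_ordP => b _; rewrite !mxE //.
rewrite [a]ord1 [b]ord1 eqxx mulr1n -cox_entry1.
by rewrite /hdim /= hom_dim_vertex.
Qed.

Lemma coxeter_insertion : #|S| != 0%N -> coxeter_poly (insertion v S) =
  \det (block_mx old_mx (in_mx *m const_mx 1) (const_mx 1 *m out_mx) poset_mx).
Proof.
move=> S0; rewrite /insertion (negPf S0).
have s0 : S by move: S0; rewrite -lt0n => /card_gt0P/sigW[].
rewrite (@coxeter_poly_reindex (quiver_algebra (ins_ideal v S)) _ _ ins_enum_bij).
have hdI (x y : ins_vert v S) : @hdim (quiver_algebra (ins_ideal v S)) x y =
    if liftable (val y) (val x)
    then hd (collapse_vertex v (val x)) (collapse_vertex v (val y))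
    else 0%N := hom_dim_insertion y x s0.
have hdv : hd v v = 1%N := hom_dim_vertex v.
congr (\det _); apply/matrixP => i j; rewrite mxE !hdI mxE /ins_enum.
case: split_ordP => b ->; case: split_ordP => a _ /=.
- by rewrite row_mxEl mxE.
- by rewrite row_mxEl mxE big_ord1 !mxE mul1r.
- by rewrite row_mxEr mxE big_ord1 !mxE mulr1.
- by rewrite row_mxEr mxE hdv; case: (_ <= _)%O; case: (_ <= _)%O.
Qed.

End Coxeter.

Theorem theorem3p15 (K : fieldType) (d : Order.disp_t) (S : finPOrderType d) :
  exists phi0 phi1 : {poly int},
    forall (L : triangular K) (v : vert (tri_quiver L)),
      coxeter_poly (insertion v S) =
        coxeter_poly (tri_algebra L) * phi0 + coxeter_poly (tri_corner v) * phi1.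
Proof.
pose k := \sum_i \sum_j (\adj (poset_mx S)) i j.
exists k, (\det (poset_mx S) - ('X + 1) * k) => L v.
have [S0|S0] := eqVneq #|S| 0%N; last first.
  rewrite coxeter_insertion // (det_insert _ _ _ _ ('X + 1)).
  by rewrite -coxeter_tri -coxeter_corner.
(* For the empty poset phi0 = 0 and phi1 = 1. *)
have -> : k = 0 by rewrite /k big1 // => -[i iS]; exfalso; rewrite S0 in iS.
have -> : \det (poset_mx S) = 1.
  by move: (poset_mx S); rewrite S0; exact: det_mx00.
by rewrite /insertion S0 eqxx !mulr0 subr0 add0r mulr1.
Qed.
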